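(* Let $\Omega\subset\mathbb{R}^2$ be an open bounded convex set with area $\mathcal{A}(\Omega)$, and let $F:M^2\to\mathbb{R}^3$ be an immersion with $F(M^2)=\Sigma$, where $\Sigma$ is a smooth, strictly convex, complete surface satisfying \[ K(p)=\frac{2\pi}{\mathcal{A}(\Omega)}\langle \vec n(p),\vec e_3\rangle\quad\text{for all }p\in M^2, \] with $K$ the Gauss curvature, $\vec n$ the interior unit normal and $\vec e_3=(0,0,1)$ (equivalently, $\Sigma$ is the boundary of $\{(x,t):x\in\Omega,\ t\ge u(x)\}$ for a convex solution $u$ of $\det D^2u/(1+|Du|^2)^{3/2}=2\pi/\mathcal{A}(\Omega)$ in $\Omega$ with $|Du|\to\infty$ at $\partial\Omega$). Let $B_R(Y)\subset\mathbb{R}^3$ be a ball and let $\Sigma_c$ be a compact surface with boundary such that $\Sigma_c\subset\Sigma$ and $\partial\Sigma_c\subset\partial B_R(Y)$. Define $\eta:M^2\to\mathbb{R}$ by $\eta(p)=(|F(p)-Y|^2-R^2)_+$ and let $\Lambda(p)=\max\{\lambda_1(p),\lambda_2(p)\}$ be the largest principal curvature of $\Sigma$ at $F(p)$. Then for every $p\in M^2$ with $F(p)\in\Sigma_c$, \[ \eta\Lambda(p)\le\frac{9\pi}{\mathcal{A}(\Omega)}\sup_{F(q)\in\Sigma_c}|F(q)-Y|^3 . \]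
   Context: $(\cdot)_+$ denotes the positive part. $\lambda_1,\lambda_2$ are the principal curvatures of $\Sigma$. *)

(* Defs.v *)
From HB Require Import structures.
From mathcomp Require Import all_boot all_order all_algebra.
From mathcomp Require Import all_classical all_reals all_analysis.
Set Implicit Arguments. Unset Strict Implicit. Unset Printing Implicit Defensive.
Import Order.TTheory GRing.Theory Num.Theory.
Import numFieldNormedType.Exports.
Local Open Scope classical_set_scope.
Local Open Scope ring_scope.

Section Defs.
Variable R : realType.
Implicit Types (u f : R -> R -> R) (O : set (R * R)).

Definition area O : R :=
  fine ((@lebesgue_measure R \x @lebesgue_measure R)%E O).

Definition dx f : R -> R -> R := fun a b => derive1 (fun t => f t b) a.
Definition dy f : R -> R -> R := fun a b => derive1 (fun t => f a t) b.

Fixpoint diter (l : seq bool) f : R -> R -> R :=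
  match l with [::] => f | i :: l' => (if i then dx else dy) (diter l' f) end.

Definition smooth_on O f : Prop :=
  forall (l : seq bool) a b, O (a, b) ->
    [/\ derivable (fun t => diter l f t b) a 1,
        derivable (fun t => diter l f a t) b 1 &
        {for (a, b), continuous (fun z : R * R => diter l f z.1 z.2)}].

Definition convex_set2 O : Prop :=
  forall z w, O z -> O w -> forall t : R, 0 <= t <= 1 ->
    O (t * z.1 + (1 - t) * w.1, t * z.2 + (1 - t) * w.2).

Definition bounded_set2 O : Prop :=
  exists M : R, forall z, O z -> `|z.1| <= M /\ `|z.2| <= M.

Definition convex_fun_on O u : Prop :=
  forall z w, O z -> O w -> forall t : R, 0 <= t <= 1 ->
    u (t * z.1 + (1 - t) * w.1) (t * z.2 + (1 - t) * w.2)
      <= t * u z.1 z.2 + (1 - t) * u w.1 w.2.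

(* Graph surface F(a,b) = (a, b, u a b).  Below: W = sqrt(1+|Du|^2),
   first fundamental form g = I + Du Du^T, second fundamental form
   h = D^2u / W (w.r.t. the upward = interior normal of the epigraph),
   Weingarten matrix L = g^{-1} h. *)
Definition gradnorm u a b : R := Num.sqrt (dx u a b ^+ 2 + dy u a b ^+ 2).
Definition Wf u a b : R := Num.sqrt (1 + dx u a b ^+ 2 + dy u a b ^+ 2).

(* interior unit normal n = (-u_x, -u_y, 1)/W ; its third component: *)
Definition normal_e3 u a b : R := (Wf u a b)^-1.

Definition weingarten u a b : R * R * R * R :=
  let p := dx u a b in let q := dy u a b in
  let r := dx (dx u) a b in let s := dy (dx u) a b in
  let t := dy (dy u) a b in let W := Wf u a b in
  let c := (W ^+ 3)^-1 in
  (* g^{-1} = [[1+q^2, -pq], [-pq, 1+p^2]] / W^2 *)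
  (c * ((1 + q ^+ 2) * r - p * q * s), c * ((1 + q ^+ 2) * s - p * q * t),
   c * ((1 + p ^+ 2) * s - p * q * r), c * ((1 + p ^+ 2) * t - p * q * s)).

Definition mean_trace u a b : R :=
  let: (l11, _, _, l22) := weingarten u a b in l11 + l22.

Definition gauss_curv u a b : R :=
  let: (l11, l12, l21, l22) := weingarten u a b in l11 * l22 - l12 * l21.

(* principal curvatures = eigenvalues of L (real, L being g-self-adjoint) *)
Definition lambda1 u a b : R :=
  (mean_trace u a b + Num.sqrt (mean_trace u a b ^+ 2 - 4 * gauss_curv u a b)) / 2.
Definition lambda2 u a b : R :=
  (mean_trace u a b - Num.sqrt (mean_trace u a b ^+ 2 - 4 * gauss_curv u a b)) / 2.

Definition Lambda u a b : R := Num.max (lambda1 u a b) (lambda2 u a b).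

Definition distY u (Y1 Y2 Y3 : R) a b : R :=
  Num.sqrt ((a - Y1) ^+ 2 + (b - Y2) ^+ 2 + (u a b - Y3) ^+ 2).

Definition etaY u (Y1 Y2 Y3 Rad : R) a b : R :=
  Num.max 0 (distY u Y1 Y2 Y3 a b ^+ 2 - Rad ^+ 2).

End Defs.

(* Main.v *)
(** Pogorelov's maximum principle.  With c = 2 pi / A(Omega), the product
    phi = eta * Lambda attains its maximum over the compact piece; if the maximum is
    positive it is interior, since eta vanishes on the boundary.  At such a point take
    a principal frame x, z and extend the principal direction x of Lambda to first
    order by parallel transport to a field v.  Since h(v, v) <= Lambda g(v, v), the
    function eta h(v, v) - m g(v, v), m = max phi, has a local maximum equal to 0
    there.  Its first and second derivatives along x and z, combined with the curvature
    equation K = c <n, e3> differentiated twice along x and once along z, eliminate all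
    derivatives of u of order at least three and leave, with X = F - Y,
    2 (l1 + l2) / c <= eta l2 <n, e3> + 2 (a1 f1 - a2 f2) - 4 <n, e3> <X, n>, where a
    and f are the tangential components of e3 and X.  By Cauchy-Schwarz this is at
    most eta l2 + 4 |X|, and l1 l2 = c <n, e3> <= c with eta <= |X|^2 gives
    eta l1 <= (9/2) c |X|^3. *)
Require Import Defs.
From HB Require Import structures.
From mathcomp Require Import all_boot all_order all_algebra.
From mathcomp Require Import all_classical all_reals all_analysis.
From mathcomp Require Import ring lra.
Import Order.TTheory GRing.Theory Num.Theory.
Import numFieldNormedType.Exports.
Local Open Scope classical_set_scope.
Local Open Scope ring_scope.

Set Implicit Arguments.
Unset Strict Implicit.

(** * Second order jets at 0 *)

(** Here [a2] is the second derivative itself, not half of it. The derivative [df] is asked for on a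
    neighbourhood of 0, so that differentiating it again at 0 makes sense. As a relation, jets can
    be assembled by the calculus rules below. *)
Definition jet2 (R : realType) (f : R -> R) (a0 a1 a2 : R) : Prop :=
  exists df : R -> R, [/\ f 0 = a0, df 0 = a1,
    \forall s \near (0 : R), is_derive s (1 : R) f (df s) &
    is_derive (0 : R) (1 : R) df a2].

Lemma jet2_val (R : realType) (f : R -> R) (a0 a1 a2 b0 b1 b2 : R) :
  jet2 f a0 a1 a2 -> a0 = b0 -> a1 = b1 -> a2 = b2 -> jet2 f b0 b1 b2.
Proof. by move=> ? <- <- <-. Qed.

Lemma jet2_cst (R : realType) (a : R) : jet2 (fun=> a) a 0 0.
Proof.
exists (fun=> 0); split => //; last exact: is_derive_cst.
by near=> s; exact: is_derive_cst.
Unshelve. all: by end_near. Qed.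

Lemma jet2_id (R : realType) : jet2 (fun s : R => s) 0 1 0.
Proof.
exists (fun=> 1); split => //; last exact: is_derive_cst.
by near=> s; exact: is_derive_id.
Unshelve. all: by end_near. Qed.

Lemma jet2_add (R : realType) (f g : R -> R) (a0 a1 a2 b0 b1 b2 : R) :
  jet2 f a0 a1 a2 -> jet2 g b0 b1 b2 ->
  jet2 (fun s => f s + g s) (a0 + b0) (a1 + b1) (a2 + b2).
Proof.
move=> [df [<- <- nf f2]] [dg [<- <- ng g2]].
exists (fun s => df s + dg s); split => //; last exact: is_deriveD.
near=> s; apply: is_deriveD; first by near: s; exact: nf.
by near: s; exact: ng.
Unshelve. all: by end_near. Qed.

Lemma is_derive_mul (R : realType) (u v : R -> R) (s du dv : R) :
  is_derive s (1 : R) u du -> is_derive s (1 : R) v dv ->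
  is_derive s (1 : R) (fun x => u x * v x) (u s * dv + du * v s).
Proof.
move=> hu hv; have := is_deriveM hu hv; move/is_derive_eq; apply.
by rewrite /GRing.scale /= (mulrC du).
Qed.

Lemma jet2_mul (R : realType) (f g : R -> R) (a0 a1 a2 b0 b1 b2 : R) :
  jet2 f a0 a1 a2 -> jet2 g b0 b1 b2 ->
  jet2 (fun s => f s * g s)
    (a0 * b0) (a0 * b1 + a1 * b0) (a0 * b2 + 2 * a1 * b1 + a2 * b0).
Proof.
move=> [df [<- <- nf f2]] [dg [<- <- ng g2]].
have f1 := nbhs_singleton nf; have g1 := nbhs_singleton ng.
exists (fun s => f s * dg s + df s * g s); split => //.
  near=> s; apply: is_derive_mul; first by near: s; exact: nf.
  by near: s; exact: ng.
have := is_deriveD (is_derive_mul f1 g2) (is_derive_mul f2 g1).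
by move/is_derive_eq; apply; ring.
Unshelve. all: by end_near. Qed.

Lemma jet2_scale (R : realType) (k : R) (f : R -> R) (a0 a1 a2 : R) :
  jet2 f a0 a1 a2 -> jet2 (fun s => k * f s) (k * a0) (k * a1) (k * a2).
Proof.
by move=> jf; apply: jet2_val (jet2_mul (jet2_cst k) jf) _ _ _; ring.
Qed.

Lemma jet2_sub (R : realType) (f g : R -> R) (a0 a1 a2 b0 b1 b2 : R) :
  jet2 f a0 a1 a2 -> jet2 g b0 b1 b2 ->
  jet2 (fun s => f s - g s) (a0 - b0) (a1 - b1) (a2 - b2).
Proof.
move=> jf /(jet2_scale (-1)) /(jet2_add jf); rewrite !mulN1r.
by congr jet2; apply: funext => s; ring.
Qed.

Lemma is_derive_continuous (R : realType) (f : R -> R) (s d : R) :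
  is_derive s (1 : R) f d -> {for s, continuous f}.
Proof.
move=> fd; apply: differentiable_continuous; apply/derivable1_diffP.
exact: ex_derive.
Qed.

(** The three equations say that the square of the jet [(w0, w1, w2)] is the jet of [f]. Positivity
    of [w0] keeps [f] positive near 0, where the root is differentiable. *)
Lemma jet2_sqrt (R : realType) (f : R -> R) (a0 a1 a2 w0 w1 w2 : R) :
  jet2 f a0 a1 a2 -> 0 < w0 -> w0 ^+ 2 = a0 -> 2 * (w0 * w1) = a1 ->
  2 * (w1 ^+ 2 + w0 * w2) = a2 -> jet2 (fun s => Num.sqrt (f s)) w0 w1 w2.
Proof.
move=> [df [f0 df0 nf f2]] w0_gt0 w0E w1E w2E.
have w0s : Num.sqrt (f 0) = w0 by rewrite f0 -w0E sqrtr_sqr gtr0_norm.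
have f1 := nbhs_singleton nf.
have fpos : \forall s \near (0 : R), 0 < f s.
  have := is_derive_continuous f1 => /(_ [set y | 0 < y]); apply.
  by apply: lt_nbhsr; rewrite f0 -w0E exprn_gt0.
have sD s : 0 < f s -> is_derive s (1 : R) f (df s) ->
    is_derive s (1 : R) (fun s => Num.sqrt (f s)) ((2 * Num.sqrt (f s))^-1 * df s).
  by move=> fs fd; have := is_derive1_comp (is_derive1_sqrt fs) fd.
exists (fun s => (2 * Num.sqrt (f s))^-1 * df s); split => //.
- by rewrite w0s df0 -w1E; field; rewrite gt_eqF.
- near=> s; apply: sD; first by near: s; exact: fpos.
  by near: s; exact: nf.
have s1 := sD 0 (nbhs_singleton fpos) f1.
have c2 := is_derive_mul (is_derive_cst (2 : R) (0 : R) (1 : R)) s1.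
have nz : (2 * Num.sqrt (f 0)) != 0 by rewrite w0s mulf_neq0 ?gt_eqF.
have := is_derive_mul (@is_deriveV R (fun x => 2 * Num.sqrt (f x)) 0 _ 1 nz c2) f2.
move/is_derive_eq; apply.
rewrite w0s df0 -w1E -w2E /GRing.scale /=; field; rewrite gt_eqF//.
Unshelve. all: by end_near. Qed.

(** This is how an identity gets differentiated: the jets computed for its two sides must
    coincide. *)
Lemma jet2_unique (R : realType) (f g : R -> R) (a0 a1 a2 b0 b1 b2 : R) :
  (\forall s \near (0 : R), f s = g s) ->
  jet2 f a0 a1 a2 -> jet2 g b0 b1 b2 -> [/\ a0 = b0, a1 = b1 & a2 = b2].
Proof.
move=> fg [df [<- <- nf f2]] [dg [<- <- ng g2]].
have dfg : \forall s \near (0 : R), df s = dg s.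
  (* Agreement near 0 is agreement near every nearby [s], so the derivatives agree near 0 as well
     and can be differentiated again. *)
  have /near_join fg' := fg.
  near=> s.
  have [_ <-] : is_derive s (1 : R) f (df s) by near: s; exact: nf.
  have [_ <-] : is_derive s (1 : R) g (dg s) by near: s; exact: ng.
  by apply: near_eq_derive; near: s; exact: fg'.
split; [exact: nbhs_singleton fg|exact: nbhs_singleton dfg|].
by case: f2 g2 => _ <- [_ <-]; exact: near_eq_derive.
Unshelve. all: by end_near. Qed.

Lemma is_derive_pos_near (R : realType) (f : R -> R) (d : R) :
  is_derive (0 : R) (1 : R) f d -> f 0 = 0 -> 0 < d ->
  \forall s \near (0 : R), 0 < s -> 0 < f s.
Proof.
move=> [fd dE] f0 d0.
have lt : \forall h \near (0 : R)^', d / 2 < h^-1 *: (f (h *: (1 : R) + 0) - f 0).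
  move/cvg_ex : (fd) => [l fl]; have ld : l = d.
    by rewrite -dE; apply/esym/cvg_lim.
  rewrite ld in fl; have := fl [set y | d / 2 < y]; apply.
  by apply: lt_nbhsr; lra.
have lt' : \forall h \near (0 : R), h != 0 -> d / 2 < h^-1 *: (f (h *: (1 : R) + 0) - f 0).
  by move: lt; rewrite /dnbhs /within.
near=> s => s0.
have : d / 2 < s^-1 *: (f (s *: (1 : R) + 0) - f 0).
  by have := s0 => /lt0r_neq0; near: s; exact: lt'.
rewrite /GRing.scale /= mulr1 addr0 f0 subr0 => h.
have : 0 < s^-1 * f s by apply: lt_trans h; rewrite divr_gt0.
by rewrite pmulr_rgt0// invr_gt0.
Unshelve. all: by end_near. Qed.

(** Fermat gives the first order condition. If [a2] were positive, [df] would be positive just to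
    the right of 0, and the mean value theorem would make [f] positive there. *)
Lemma jet2_max (R : realType) (f : R -> R) (a0 a1 a2 : R) :
  (\forall s \near (0 : R), f s <= 0) -> jet2 f a0 a1 a2 -> a0 = 0 ->
  a1 = 0 /\ a2 <= 0.
Proof.
move=> fneg [df [f0 <- nf f2]] a00; rewrite {}a00 in f0.
have f1 := nbhs_singleton nf.
have df0 : df 0 = 0.
  have [e /= e0 he] : exists2 e : R, 0 < e & forall s, `|s| < e ->
      f s <= 0 /\ is_derive s (1 : R) f (df s).
    have : \forall s \near (0 : R), f s <= 0 /\ is_derive s (1 : R) f (df s).
      by apply: filterS2 fneg nf.
    by move=> /nbhs_ballP[e e0 he]; exists e => // s se; apply: he; rewrite /ball /= sub0r normrN.
  have e2 s : s \in `](- e), e[%R -> `|s| < e by rewrite in_itv/= ltr_norml.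
  suff [_ d0] : is_derive (0 : R) (1 : R) f 0 by case: f1 => _ <-.
  apply: (@derive1_at_max R f (- e) e 0).
  - by rewrite ge0_cp// ltW.
  - by move=> t /e2 /he[_ ?].
  - by rewrite in_itv /= oppr_lt0 e0.
  - by move=> t /e2 /he[+ _]; rewrite f0.
split=> //; rewrite leNgt; apply/negP => a20.
have dpos := is_derive_pos_near f2 df0 a20.
have : \forall s \near (0 : R), [/\ 0 < s -> 0 < df s, f s <= 0 & is_derive s (1 : R) f (df s)].
  by apply: filterS3 dpos fneg nf.
move=> /nbhs_ballP[e /= e0 he].
have he' s : `|s| < e -> [/\ 0 < s -> 0 < df s, f s <= 0 & is_derive s (1 : R) f (df s)].
  by move=> se; apply: he; rewrite /ball /= sub0r normrN.
have e20 : 0 < e / 2 by rewrite divr_gt0.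
have small s : 0 <= s <= e / 2 -> `|s| < e.
  by move=> /andP[s0 se]; rewrite ger0_norm//; lra.
have [||c cI] := @MVT R f df 0 (e / 2) e20.
- by move=> x; rewrite in_itv /= => /andP[x0 xe]; have [] := he' x (small _ _) => //; apply/andP; split; exact: ltW.
- apply: derivable_within_continuous => x; rewrite in_itv /= => xI.
  by have [_ _ ?] := he' x (small _ xI).
move: cI; rewrite in_itv /= => /andP[c0 ce].
have cI : 0 <= c <= e / 2 by rewrite !ltW.
have eI : 0 <= e / 2 <= e / 2 by rewrite lexx ltW.
have [/(_ c0) dc _ _] := he' c (small _ cI).
have [_ fe _] := he' _ (small _ eI).
by rewrite f0 !subr0 => fE; move: fe; rewrite fE leNgt mulr_gt0.
Qed.

(** * Partial derivatives along lines *)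

Lemma is_derive_affine (R : realType) (f : R -> R) (a k s d : R) :
  is_derive (a + s * k) (1 : R) f d ->
  is_derive s (1 : R) (fun s => f (a + s * k)) (k * d).
Proof.
move=> fd; rewrite mulrC; apply: (is_derive1_comp (f := f)) => //.
have := is_deriveD (is_derive_cst a s (1 : R))
  (is_derive_mul (is_derive_id s (1 : R)) (is_derive_cst k s (1 : R))).
by move/is_derive_eq; apply; rewrite mulr0 mul1r !add0r.
Qed.

(** Locating the intermediate point by a fraction [t] of the step covers steps of either sign, and
    the zero step. *)
Lemma mvt_step (R : realType) (f : R -> R) (a h : R) :
  (forall t : R, 0 <= t <= 1 -> derivable f (a + t * h) 1) ->
  exists2 t, 0 <= t <= 1 & f (a + h) - f a = h * derive1 f (a + t * h).
Proof.
move=> fd.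
have gd (t : R) : 0 <= t <= 1 ->
    is_derive t (1 : R) (fun t => f (a + t * h)) (h * derive1 f (a + t * h)).
  by move=> t01; apply: is_derive_affine; rewrite derive1E; apply/derivableP; exact: fd.
have [||t t01] := @MVT R (fun t => f (a + t * h))
  (fun t => h * derive1 f (a + t * h)) 0 1 ltr01.
- by move=> t; rewrite in_itv /= => /andP[t0 t1]; apply: gd; rewrite !ltW.
- apply: derivable_within_continuous => t; rewrite in_itv /= => t01.
  by have [? _] := gd t t01.
rewrite mul0r addr0 mul1r subr0 mulr1 => ->; exists t => //.
by move: t01; rewrite in_itv /= => /andP[t0 t1]; rewrite !ltW.
Qed.

Lemma open_box (R : realType) (O : set (R * R)) (a b : R) :
  open O -> O (a, b) -> exists2 e : R, 0 < e &
    forall h k, `|h| < e -> `|k| < e -> O (a + h, b + k).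
Proof.
move=> oO Oab; have /nbhs_ballP[e /= e0 he] : nbhs (a, b) O by exact: open_nbhs_nbhs.
exists e => // h k h_e k_e; apply: he; split; rewrite /ball /= opprD addNKr normrN//.
Qed.

Lemma continuous_box (R : realType) (g : R * R -> R) (a b e : R) :
  {for (a, b), continuous g} -> 0 < e -> exists2 d : R, 0 < d &
    forall h k, `|h| < d -> `|k| < d -> `|g (a + h, b + k) - g (a, b)| < e.
Proof.
move=> cg e0; have := cg (ball (g (a, b)) e) (nbhsx_ballx _ _ e0).
move=> /nbhs_ballP[d /= d0 hd]; exists d => // h k h_d k_d.
rewrite distrC; apply: hd; split; rewrite /ball /= opprD addNKr normrN//.
Qed.

Lemma is_derive_of_limit (R : realType) (f : R -> R) (d : R) :
  (forall e : R, 0 < e -> exists2 r : R, 0 < r &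
     forall h, h != 0 -> `|h| < r -> `|h^-1 * (f h - f 0) - d| < e) ->
  is_derive (0 : R) (1 : R) f d.
Proof.
move=> H; suff c : h^-1 *: (f (h *: (1 : R) + 0) - f 0) @[h --> (0 : R)^'] --> d.
  by split; [apply/cvg_ex; exists d|apply/cvg_lim].
apply/cvgrPdist_lt => e e0; have [r r0 hr] := H e e0.
near=> h; rewrite distrC /GRing.scale /= mulr1 addr0; apply: hr.
  by near: h; exact: nbhs_dnbhs_neq.
by near: h; exact: dnbhs0_lt.
Unshelve. all: by end_near. Qed.

(** The increment splits into a horizontal move at height [b + s * be], controlled by the mean value
    theorem and continuity of [dx f], and a vertical move at abscissa [a], which needs only
    derivability in the second variable. *)
Lemma is_derive_line0 (R : realType) (O : set (R * R)) (f : R -> R -> R)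
    (a b al be : R) :
  open O -> O (a, b) ->
  (forall x y, O (x, y) -> derivable (fun t => f t y) x 1) ->
  derivable (fun t => f a t) b 1 ->
  {for (a, b), continuous (fun z : R * R => dx f z.1 z.2)} ->
  is_derive (0 : R) (1 : R) (fun s => f (a + s * al) (b + s * be))
    (al * dx f a b + be * dy f a b).
Proof.
move=> oO Oab fx fy cx.
have F2 : is_derive (0 : R) (1 : R) (fun s => f a (b + s * be)) (be * dy f a b).
  apply: is_derive_affine; rewrite mul0r addr0 /dy derive1E.
  exact: (DeriveDef fy erefl).
suff F1 : is_derive (0 : R) (1 : R)
    (fun s => f (a + s * al) (b + s * be) - f a (b + s * be)) (al * dx f a b).
  have := is_deriveD F1 F2; congr is_derive; apply: funext => s /=.
  by rewrite /GRing.add /= subrK.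
apply: is_derive_of_limit => e e0.
have [r r0 hr] := open_box oO Oab.
(* The added 1 keeps the denominator nonzero when [al] vanishes. *)
have e'0 : 0 < e / (`|al| + 1) by rewrite divr_gt0// ltr_pwDr.
have [d d0 hd] := continuous_box cx e'0.
pose M := `|al| + `|be| + 1.
have M0 : 0 < M by rewrite ltr_pwDr// addr_ge0.
have bd (t k h m : R) : 0 <= t <= 1 -> `|k| <= M -> `|h| < m / M -> `|t * (h * k)| < m.
  move=> /andP[t0 t1] kM hm; rewrite !normrM (ger0_norm t0).
  apply: (@le_lt_trans _ _ (`|h| * M)); last by rewrite -ltr_pdivlMr.
  rewrite -[leRHS]mul1r ler_pM// ?mulr_ge0// ler_wpM2l//.
have alM : `|al| <= M by rewrite /M -addrA lerDl addr_ge0.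
have beM : `|be| <= M by rewrite /M addrAC lerDr addr_ge0.
exists (Num.min r d / M).
  by rewrite divr_gt0// lt_min r0 d0.
move=> h h0 hrd.
have I1 : 0 <= (1 : R) <= 1 by rewrite lexx ler01.
have hrM : `|h| < r / M by apply: lt_le_trans hrd _; rewrite ler_pM2r ?invr_gt0// ge_min lexx.
have hdM : `|h| < d / M by apply: lt_le_trans hrd _; rewrite ler_pM2r ?invr_gt0// ge_min lexx orbT.
have hb m : `|h| < m / M -> `|h * be| < m by move=> /(bd 1 be h m I1 beM); rewrite mul1r.
have [|t t01 ->] := @mvt_step R (fun x => f x (b + h * be)) a (h * al).
  by move=> t t01; apply: fx; apply: hr; [exact: bd|exact: hb].
rewrite !mul0r !addr0 subrr subr0 -mulrA mulKf// -mulrBr normrM.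
have := hd (t * (h * al)) (h * be) (bd _ _ _ _ t01 alM hdM) (hb _ hdM).
rewrite /= -/(dx f _ _) => lt1.
apply: (@le_lt_trans _ _ (`|al| * (e / (`|al| + 1)))).
  by rewrite ler_wpM2l// ltW.
rewrite mulrA ltr_pdivrMr ?ltr_pwDr// mulrC mulrDr mulr1 ltr_pwDr// mulrC.
Qed.

(** The mean value theorem is used twice: in the first variable on the difference of [f] at heights
    [b + h] and [b], then in the second variable on [dx f]. *)
Lemma second_difference (R : realType) (f : R -> R -> R) (a b h : R) :
  (forall s t : R, 0 <= s <= 1 -> 0 <= t <= 1 ->
     derivable (fun x => f x (b + t * h)) (a + s * h) 1 /\
     derivable (fun y => dx f (a + s * h) y) (b + t * h) 1) ->
  exists s t : R, [/\ 0 <= s <= 1, 0 <= t <= 1 &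
    f (a + h) (b + h) - f (a + h) b - (f a (b + h) - f a b) =
      h * (h * dy (dx f) (a + s * h) (b + t * h))].
Proof.
move=> H.
have i0 : 0 <= (0 : R) <= 1 by rewrite lexx ler01.
have i1 : 0 <= (1 : R) <= 1 by rewrite lexx ler01.
have gd (s : R) : 0 <= s <= 1 -> is_derive (a + s * h) (1 : R)
    (fun x => f x (b + h) - f x b) (dx f (a + s * h) (b + h) - dx f (a + s * h) b).
  move=> s01; have [d1 _] := H s 1 s01 i1; have [d0 _] := H s 0 s01 i0.
  move: d1 d0; rewrite mul1r mul0r addr0 => d1 d0.
  by rewrite /dx !derive1E; exact: (is_deriveB (DeriveDef d1 erefl) (DeriveDef d0 erefl)).
have [|s s01] := @mvt_step R (fun x => f x (b + h) - f x b) a h.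
  by move=> s s01; have [? _] := gd s s01.
rewrite derive1E (@derive_val _ _ _ _ _ _ _ (gd s s01)) => gE.
have [|t t01 tE] := @mvt_step R (fun y => dx f (a + s * h) y) b h.
  by move=> t t01; have [_ ?] := H s t s01 t01.
by exists s, t; split => //; rewrite gE tE.
Qed.

(** One second difference over a small square equals [h ^+ 2] times either mixed derivative at some
    point of the square. If the mixed derivatives differed by [e] at the corner, continuity within
    [e / 2] would be contradicted. *)
Lemma schwarz (R : realType) (O : set (R * R)) (f : R -> R -> R) (a b : R) :
  open O -> O (a, b) ->
  (forall x y, O (x, y) ->
    [/\ derivable (fun t => f t y) x 1, derivable (fun t => f x t) y 1,
        derivable (fun t => dx f x t) y 1 & derivable (fun t => dy f t y) x 1]) ->
  {for (a, b), continuous (fun z : R * R => dy (dx f) z.1 z.2)} ->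
  {for (a, b), continuous (fun z : R * R => dx (dy f) z.1 z.2)} ->
  dx (dy f) a b = dy (dx f) a b.
Proof.
move=> oO Oab H c1 c2; apply/eqP; rewrite -subr_eq0 -normr_le0 leNgt.
apply/negP; set e := `|_| => e0.
have e20 : 0 < e / 2 by rewrite divr_gt0.
have [r r0 hr] := open_box oO Oab.
have [d1 d10 hd1] := continuous_box c1 e20.
have [d2 d20 hd2] := continuous_box c2 e20.
pose h := Num.min r (Num.min d1 d2) / 2.
have m0 : 0 < Num.min r (Num.min d1 d2) by rewrite !lt_min r0 d10.
have h0 : 0 < h by rewrite divr_gt0.
have hm : h < Num.min r (Num.min d1 d2) by rewrite /h ltr_pdivrMr// ltr_pMr// ltr1n.
move: (hm); rewrite !lt_min => /and3P[hr' h1' h2'].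
have bd (t m : R) : 0 <= t <= 1 -> h < m -> `|t * h| < m.
  move=> /andP[t0 t1]; apply: le_lt_trans; have hge := ltW h0.
  by rewrite ger0_norm; [exact: ler_piMl|exact: mulr_ge0].
have [s [t [s01 t01 E1]]] := @second_difference R f a b h (fun s t s01 t01 =>
  let: And4 p _ q _ := H _ _ (hr _ _ (bd _ _ s01 hr') (bd _ _ t01 hr')) in conj p q).
have [s' [t' [s01' t01' E2]]] := @second_difference R (fun y x => f x y) b a h
  (fun t s t01 s01 =>
  let: And4 _ p _ q := H _ _ (hr _ _ (bd _ _ s01 hr') (bd _ _ t01 hr')) in conj p q).
have E3 : dy (dx f) (a + s * h) (b + t * h) = dx (dy f) (a + t' * h) (b + s' * h).
  apply: (mulfI (lt0r_neq0 h0)); apply: (mulfI (lt0r_neq0 h0)).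
  have swap (X Y Z T : R) : X - Y - (Z - T) = X - Z - (Y - T) by ring.
  exact: (etrans (esym E1) (etrans (swap _ _ _ _) E2)).
have /= := hd1 _ _ (bd _ _ s01 h1') (bd _ _ t01 h1').
have /= := hd2 _ _ (bd _ _ t01' h2') (bd _ _ s01' h2').
rewrite E3 /e; move: (dx (dy f) _ _) (dx (dy f) a b) (dy (dx f) a b) => X Y Z A B.
have := ltrD A B; rewrite -splitr (distrC X Y) ltNge => /negP; apply.
exact: ler_distD.
Qed.

(** A normal form: derivatives in the first variable are taken first. A further [dy] then raises [j]
    by computation, whereas a further [dx] has to be commuted inwards. *)
Definition pderiv (R : realType) (u : R -> R -> R) (i j : nat) : R -> R -> R :=
  diter (nseq j false ++ nseq i true) u.

Lemma dx_pderiv (R : realType) (O : set (R * R)) (u : R -> R -> R) (i j : nat) a b :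
  open O -> smooth_on O u -> O (a, b) -> dx (pderiv u i j) a b = pderiv u i.+1 j a b.
Proof.
move=> oO su; elim: j a b => [//|j IH] a b Oab.
have -> : dx (pderiv u i j.+1) a b = dx (dy (pderiv u i j)) a b by [].
rewrite (schwarz oO Oab).
(* The induction hypothesis is differentiated in the second variable, so it is needed at all nearby
   points of the vertical line. *)
- rewrite -[RHS]/(dy (pderiv u i.+1 j) a b) /dy !derive1E; apply: near_eq_derive.
  have [r r0 hr] := open_box oO Oab.
  apply/nbhs_ballP; exists r => // y; rewrite /ball /= => yb; apply: IH.
  have := hr 0 (y - b); rewrite addr0 (addrC b) subrK; apply; rewrite ?normr0// distrC//.
- move=> x y Oxy; have [d1 d2 _] := su (nseq j false ++ nseq i true) _ _ Oxy.
  have [_ d3 _] := su (true :: nseq j false ++ nseq i true) _ _ Oxy.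
  have [d4 _ _] := su (false :: nseq j false ++ nseq i true) _ _ Oxy.
  exact: (And4 d1 d2 d3 d4).
- have [_ _ c] := su [:: false, true & nseq j false ++ nseq i true] _ _ Oab.
  exact: c.
- have [_ _ c] := su [:: true, false & nseq j false ++ nseq i true] _ _ Oab.
  exact: c.
Qed.

Lemma is_derive_line (R : realType) (O : set (R * R)) (u : R -> R -> R)
    (i j : nat) (a b al be s : R) :
  open O -> smooth_on O u -> O (a + s * al, b + s * be) ->
  is_derive s (1 : R) (fun s => pderiv u i j (a + s * al) (b + s * be))
    (al * pderiv u i.+1 j (a + s * al) (b + s * be) +
     be * pderiv u i j.+1 (a + s * al) (b + s * be)).
Proof.
move=> oO su Os; pose l := nseq j false ++ nseq i true.
have [_ fy _] := su l _ _ Os.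
have [_ _ cx] := su (true :: l) _ _ Os.
have fx x y : O (x, y) -> derivable (fun t => pderiv u i j t y) x 1.
  by move=> Oxy; have [d _ _] := su l _ _ Oxy; exact: d.
have := is_derive_line0 al be oO Os fx fy cx.
rewrite (dx_pderiv _ _ oO su Os) => F0.
(* [is_derive_line0] differentiates only at parameter 0; the shift by [- s] moves this to parameter
   [s]. *)
have := @is_derive_affine R (fun x => pderiv u i j (a + s * al + x * al) (b + s * be + x * be))
  (- s) 1 s _.
rewrite mulr1 addNr => /(_ _ F0); rewrite mul1r; congr is_derive.
by apply: funext => x; congr (pderiv u i j _ _); ring.
Qed.

Lemma near_line (R : realType) (O : set (R * R)) (a b al be : R) :
  open O -> O (a, b) -> \forall s \near (0 : R), O (a + s * al, b + s * be).
Proof.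
move=> oO Oab; have [r r0 hr] := open_box oO Oab.
have M0 : 0 < `|al| + `|be| + 1 by rewrite ltr_pwDr// addr_ge0.
have bd (s k : R) : `|k| <= `|al| + `|be| + 1 -> `|s| < r / (`|al| + `|be| + 1) ->
    `|s * k| < r.
  move=> kM sm; rewrite normrM; apply: le_lt_trans (_ : `|s| * (`|al| + `|be| + 1) < _).
    by rewrite ler_wpM2l.
  by rewrite -ltr_pdivlMr.
apply/nbhs_ballP; exists (r / (`|al| + `|be| + 1)); first by rewrite /= divr_gt0.
move=> s; rewrite /ball /= sub0r normrN => sm.
apply: hr; apply: bd => //; first by rewrite -addrA lerDl addr_ge0.
by rewrite addrAC lerDr addr_ge0.
Qed.

Lemma jet2_line (R : realType) (O : set (R * R)) (u : R -> R -> R)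
    (i j : nat) (a b al be : R) :
  open O -> smooth_on O u -> O (a, b) ->
  jet2 (fun s => pderiv u i j (a + s * al) (b + s * be)) (pderiv u i j a b)
    (al * pderiv u i.+1 j a b + be * pderiv u i j.+1 a b)
    (al ^+ 2 * pderiv u i.+2 j a b + 2 * al * be * pderiv u i.+1 j.+1 a b +
      be ^+ 2 * pderiv u i j.+2 a b).
Proof.
move=> oO su Oab.
exists (fun s => al * pderiv u i.+1 j (a + s * al) (b + s * be) +
     be * pderiv u i j.+1 (a + s * al) (b + s * be)); split.
- by rewrite !mul0r !addr0.
- by rewrite !mul0r !addr0.
- apply: filterS (near_line al be oO Oab) => s; exact: is_derive_line.
have O0 : O (a + 0 * al, b + 0 * be) by rewrite !mul0r !addr0.
have h1 := is_derive_line i.+1 j oO su O0; have h2 := is_derive_line i j.+1 oO su O0.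
have c (k : R) := is_derive_cst k (0 : R) (1 : R).
have := is_deriveD (is_derive_mul (c al) h1) (is_derive_mul (c be) h2).
move/is_derive_eq; apply; rewrite !mul0r !addr0 /cst /=; ring.
Qed.

(** * Algebra at the maximum point *)

(* The last two hypotheses are the second derivative tests along the two principal
   directions.  Weighting them by [l2] and [l1] produces the fourth derivatives in
   the combination given by the twice differentiated curvature equation; the third
   derivatives are fixed by the first order conditions. *)
Lemma pogorelov_combination (R : realType)
    (W l1 l2 e P1 P2 f1 f2 X3 T111 T112 T122 T222 Q1111 Q1122 : R) :
  0 < W -> 0 < l1 -> 0 < l2 -> 0 < e ->
  2 * f1 * (W * l1) + e * (T111 - 3 * W ^+ 2 * l1 ^+ 2 * P1) = 0 ->
  2 * f2 * (W * l1) + e * (T112 - l1 * l2 * W ^+ 2 * P2) = 0 ->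
  T111 * l2 + l1 * T122 = 3 * W ^+ 2 * l1 ^+ 2 * l2 * P1 ->
  T112 * l2 + l1 * T222 = 3 * W ^+ 2 * l1 * l2 ^+ 2 * P2 ->
  Q1111 * W * l2 + 2 * T111 * T122 + W * l1 * Q1122 - 2 * T112 ^+ 2 =
    l1 * l2 * (6 * W ^+ 4 * P1 ^+ 2 * l1 ^+ 2 + 3 * W ^+ 2 * l1 ^+ 2 +
               3 * W ^+ 2 * (P1 * T111 + P2 * T112)) ->
  (2 + 2 * X3 * W * l1) * (W * l1) + 4 * f1 * (T111 - 2 * W ^+ 2 * l1 ^+ 2 * P1) +
   e * (Q1111 - 4 * W * l1 * (P1 * T111 + P2 * T112) +
        2 * W ^+ 3 * l1 ^+ 2 * (P1 ^+ 2 * l1 + P2 ^+ 2 * l2)) -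
   e * l1 * (W * l1 ^+ 2 + W * (P1 * T111 + P2 * T112) +
     W * (2 * l1 ^+ 2 + 2 * P1 * T111 - 4 * W ^+ 2 * l1 ^+ 2 * P1 ^+ 2)) <= 0 ->
  (2 + 2 * X3 * W * l2) * (W * l1) + 4 * f2 * T112 + e * Q1122 -
   e * l1 * (W * l2 ^+ 2 + W * (P1 * T122 + P2 * T222) + 2 * W * P1 * T122) <= 0 ->
  2 * (l1 + l2) <=
    l1 * l2 * (e * l2 + 2 * W * (P1 * f1 - P2 * f2) -
               4 * (W * (X3 - P1 * f1 - P2 * f2))).
Proof.
move=> W0 l10 l20 e0 h1 h2 k1 k2 k3 i1 i2.
have nW := lt0r_neq0 W0; have n1 := lt0r_neq0 l10; have n2 := lt0r_neq0 l20.
have ne := lt0r_neq0 e0.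
(* The first order conditions fix [T111] and [T112], the once differentiated equation fixes [T122]
   and [T222], and the twice differentiated one fixes [Q1111] in terms of [Q1122]. *)
have E111 : T111 = 3 * W ^+ 2 * l1 ^+ 2 * P1 - 2 * f1 * (W * l1) / e.
  have -> : 2 * f1 * (W * l1) = - (e * (T111 - 3 * W ^+ 2 * l1 ^+ 2 * P1)) by lra.
  by field.
have E112 : T112 = l1 * l2 * W ^+ 2 * P2 - 2 * f2 * (W * l1) / e.
  have -> : 2 * f2 * (W * l1) = - (e * (T112 - l1 * l2 * W ^+ 2 * P2)) by lra.
  by field.
have E122 : T122 = 2 * f1 * (W * l2) / e.
  have -> : T122 = (3 * W ^+ 2 * l1 ^+ 2 * l2 * P1 - T111 * l2) / l1.
    by rewrite -k1; field.
  by rewrite E111; field; rewrite ne n1.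
have E222 : T222 = (3 * W ^+ 2 * l1 * l2 ^+ 2 * P2 - T112 * l2) / l1.
  by rewrite -k2; field.
have EQ : Q1111 = (l1 * l2 * (6 * W ^+ 4 * P1 ^+ 2 * l1 ^+ 2 + 3 * W ^+ 2 * l1 ^+ 2 +
   3 * W ^+ 2 * (P1 * T111 + P2 * T112)) - 2 * T111 * T122 + 2 * T112 ^+ 2
   - W * l1 * Q1122) / (W * l2).
  by rewrite -k3; field; rewrite nW n2.
(* With these weights [Q1122] cancels, and the sum is exactly [l1 * W] times the difference of the
   two sides of the goal. *)
have := lerD (mulr_ge0_le0 (ltW l20) i1) (mulr_ge0_le0 (ltW l10) i2).
rewrite addr0 => J; rewrite -subr_le0 -(pmulr_rle0 _ (mulr_gt0 l10 W0)).
apply: le_trans J; rewrite le_eqVlt; apply/orP; left; apply/eqP.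
rewrite EQ E222 E122 E112 E111; field.
by rewrite ne nW n1 n2.
Qed.

(** [(P1, P2, W^-1)] and [(f1, f2, N)] are the components of e3 and of F - Y in the orthonormal
    frame formed by the principal directions and the normal. *)
Lemma frame_bound (R : realType) (W l1 l2 e P1 P2 f1 f2 N c rho : R) :
  0 < W -> 0 < l1 -> 0 < l2 -> 0 < e -> 0 < c -> 0 <= rho ->
  W ^+ 2 * (P1 ^+ 2 + P2 ^+ 2) = W ^+ 2 - 1 ->
  f1 ^+ 2 + f2 ^+ 2 + N ^+ 2 = rho ^+ 2 -> e <= rho ^+ 2 -> l1 * l2 = c / W ->
  2 * (l1 + l2) <= l1 * l2 * (e * l2 + 2 * W * (P1 * f1 - P2 * f2) - 4 * N) ->
  e * l1 <= 9 / 2 * c * rho ^+ 3.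
Proof.
move=> W0 l10 l20 e0 c0 rho0 hP hr er lc main.
pose nu := W^-1.
have nu0 : 0 < nu by rewrite invr_gt0.
have Wnu : W * nu = 1 by rewrite divff// gt_eqF.
have Pnu : P1 ^+ 2 + P2 ^+ 2 + nu ^+ 2 = 1.
  have W20 : W ^+ 2 != 0 by rewrite expf_eq0 /= gt_eqF.
  apply: (mulfI W20); rewrite mulrDr hP -exprMn Wnu; ring.
have nu1 : nu <= 1.
  have : nu ^+ 2 <= 1 by rewrite -[leRHS]Pnu lerDr addr_ge0 ?sqr_ge0.
  by rewrite expr_le1// ltW.
have rho_gt0 : 0 < rho.
  rewrite lt_neqAle rho0 andbT eq_sym; apply/eqP => r0.
  by move: er; rewrite r0 expr0n /= leNgt e0.
(* Cauchy-Schwarz against the vector [(P1, - P2, - 2 * nu)], whose squared length is 4 - 3 (P1^2 +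
   P2^2), at most 4. *)
have CS : P1 * f1 - P2 * f2 - 2 * nu * N <= 2 * rho.
  suff : (P1 * f1 - P2 * f2 - 2 * nu * N) ^+ 2 <= (2 * rho) ^+ 2.
    rewrite -ler_sqrt ?sqr_ge0// !sqrtr_sqr (ger0_norm (_ : 0 <= 2 * rho)).
      by apply: le_trans; exact: ler_norm.
    by rewrite mulr_ge0.
  rewrite exprMn -hr -subr_ge0.
  (* The three squares are the Lagrange identity for this pair of vectors; the last term vanishes by
     [Pnu]. *)
  have -> : 2 ^+ 2 * (f1 ^+ 2 + f2 ^+ 2 + N ^+ 2) - (P1 * f1 - P2 * f2 - 2 * nu * N) ^+ 2 =
    (3 * P1 ^+ 2 + 3 * P2 ^+ 2) * (f1 ^+ 2 + f2 ^+ 2 + N ^+ 2)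
    + (P1 * f2 + P2 * f1) ^+ 2 + (P1 * N + 2 * nu * f1) ^+ 2 + (P2 * N - 2 * nu * f2) ^+ 2
    + 4 * (1 - (P1 ^+ 2 + P2 ^+ 2 + nu ^+ 2)) * (f1 ^+ 2 + f2 ^+ 2 + N ^+ 2) by ring.
  rewrite Pnu subrr mulr0 mul0r addr0 !addr_ge0 ?sqr_ge0// mulr_ge0 ?hr ?sqr_ge0//.
  by rewrite addr_ge0 // mulr_ge0 ?sqr_ge0.
have l2b : 2 * (l1 + l2) <= c * (e * l2 + 4 * rho).
  apply: le_trans main _; rewrite lc.
  have -> : c / W * (e * l2 + 2 * W * (P1 * f1 - P2 * f2) - 4 * N) =
    c * (e * l2 * nu + 2 * (P1 * f1 - P2 * f2 - 2 * nu * N)).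
    rewrite /nu; field; exact: lt0r_neq0.
  rewrite ler_pM2l// lerD//; last by lra.
  by rewrite ler_piMr// ltW// mulr_gt0.
(* If [e * l1] were too large, the product [l1 * l2 <= c] would force [e * l2] below 2 rho / 9. Then
   [l2b] gives 2 l1 < 5 c rho, hence e l1 <= (5/2) c rho^3, a contradiction. *)
rewrite leNgt; apply/negP => big.
have r3 : 0 < rho ^+ 3 by rewrite exprn_gt0.
have A : e * l2 * (9 / 2) < rho.
  have : e * l2 * (9 / 2 * c * rho ^+ 3) < rho * (c * rho ^+ 3).
    apply: (@lt_le_trans _ _ (e * l2 * (e * l1))).
      by rewrite ltr_pM2l ?mulr_gt0.
    have -> : e * l2 * (e * l1) = (e * e) * (l1 * l2) by ring.
    have -> : rho * (c * rho ^+ 3) = (rho ^+ 2 * rho ^+ 2) * c by ring.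
    apply: ler_pM; rewrite ?mulr_ge0 ?(ltW e0) ?(ltW l10) ?(ltW l20)//.
      by rewrite ler_pM// ltW.
    by rewrite lc ler_piMr// ltW.
  have -> : e * l2 * (9 / 2 * c * rho ^+ 3) = (e * l2 * (9 / 2)) * (c * rho ^+ 3) by ring.
  by rewrite ltr_pM2r// mulr_gt0.
have B : 2 * l1 < c * (5 * rho).
  have : c * (e * l2 + 4 * rho) < c * (5 * rho) by rewrite ltr_pM2l//; lra.
  by move=> h; lra.
have C : e * (2 * l1) <= rho ^+ 2 * (c * (5 * rho)).
  by apply: ler_pM; rewrite ?(ltW e0) ?(ltW B)// mulr_ge0// ltW.
have D : rho ^+ 2 * (c * (5 * rho)) = 5 * (c * rho ^+ 3) by ring.
have E : 0 < c * rho ^+ 3 by rewrite mulr_gt0.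
rewrite D in C.
have E' : 9 / 2 * c * rho ^+ 3 = 9 / 2 * (c * rho ^+ 3) by ring.
have C' : e * (2 * l1) = 2 * (e * l1) by ring.
rewrite E' in big; rewrite C' in C; lra.
Qed.

(** * Principal curvatures of a graph *)

(** If [A] were negative, the positive definite form [(E, F, G)] would take at [(- B, A)] the value
    [A] times the trace, which is not positive; likewise for [C]. Completing the square then
    suffices. *)
Lemma degenerate_form_ge0 (R : realFieldType) (A B C E F G : R) :
  0 < E -> 0 < E * G - F ^+ 2 -> A * C = B ^+ 2 ->
  0 <= G * A - 2 * F * B + E * C ->
  forall x y, 0 <= A * x ^+ 2 + 2 * B * x * y + C * y ^+ 2.
Proof.
move=> E0 D0 AC tr.
have G0 : 0 < G.
  have EG : 0 < E * G by apply: lt_le_trans D0 _; rewrite gerBl sqr_ge0.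
  by rewrite pmulr_rgt0 in EG.
have gpos (u v : R) : u != 0 \/ v != 0 -> 0 < E * u ^+ 2 + 2 * F * u * v + G * v ^+ 2.
  move=> uv; rewrite -(pmulr_rgt0 _ E0).
  have -> : E * (E * u ^+ 2 + 2 * F * u * v + G * v ^+ 2) =
    (E * u + F * v) ^+ 2 + (E * G - F ^+ 2) * v ^+ 2 by ring.
  have [v0|v0] := eqVneq v 0.
    case: uv => [u0|]; last by rewrite v0 eqxx.
    by rewrite v0 mulr0 addr0 expr0n /= mulr0 addr0 exprn_even_gt0//= mulf_neq0// gt_eqF.
  by rewrite ltr_wpDl ?sqr_ge0// mulr_gt0// exprn_even_gt0.
have A0 : 0 <= A.
  rewrite leNgt; apply/negP => A0.
  have /gpos : - B != 0 \/ A != 0 by right; rewrite lt_eqF.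
  have -> : E * (- B) ^+ 2 + 2 * F * - B * A + G * A ^+ 2 = A * (G * A - 2 * F * B + E * C).
    by rewrite sqrrN -AC; ring.
  by rewrite ltNge mulr_le0_ge0// ltW.
have C0 : 0 <= C.
  rewrite leNgt; apply/negP => C0.
  have /gpos : C != 0 \/ - B != 0 by left; rewrite lt_eqF.
  have -> : E * C ^+ 2 + 2 * F * C * - B + G * (- B) ^+ 2 = C * (G * A - 2 * F * B + E * C).
    by rewrite sqrrN -AC; ring.
  by rewrite ltNge mulr_le0_ge0// ltW.
move=> x y; have [Az|An] := eqVneq A 0.
  have Bz : B = 0 by apply/eqP; rewrite -sqrf_eq0 -AC Az mul0r.
  by rewrite Az Bz mulr0 !mul0r !add0r mulr_ge0// sqr_ge0.
have Ap : 0 < A by rewrite lt_neqAle eq_sym An.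
rewrite -(pmulr_rge0 _ Ap).
have -> : A * (A * x ^+ 2 + 2 * B * x * y + C * y ^+ 2) =
  (A * x + B * y) ^+ 2 + (A * C - B ^+ 2) * y ^+ 2 by ring.
by rewrite AC subrr mul0r addr0 sqr_ge0.
Qed.

(** A symmetric form has real eigenvalues relative to a metric: multiplied by [E ^+ 2], the
    discriminant is a sum of nonnegative terms. *)
Lemma pencil_discriminant (R : realFieldType) (r s t E F G : R) :
  0 < E -> 0 < E * G - F ^+ 2 ->
  0 <= (G * r - 2 * F * s + E * t) ^+ 2 - 4 * (E * G - F ^+ 2) * (r * t - s ^+ 2).
Proof.
move=> E0 D0; rewrite -(pmulr_rge0 _ (exprn_gt0 2 E0)).
have -> : E ^+ 2 * ((G * r - 2 * F * s + E * t) ^+ 2 - 4 * (E * G - F ^+ 2) * (r * t - s ^+ 2))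
  = (2 * F ^+ 2 * r - 2 * E * F * s + E ^+ 2 * t - E * G * r) ^+ 2
    + 4 * ((E * G - F ^+ 2) * (E * s - F * r) ^+ 2) by ring.
by rewrite addr_ge0 ?sqr_ge0// mulr_ge0// mulr_ge0 ?sqr_ge0// ltW.
Qed.

Lemma kernel_vector (R : realFieldType) (A B C : R) : A * C = B ^+ 2 ->
  exists x y, [/\ x != 0 \/ y != 0, A * x + B * y = 0 & B * x + C * y = 0].
Proof.
move=> AC; have [A0|A0] := eqVneq A 0.
  have B0 : B = 0 by apply/eqP; rewrite -sqrf_eq0 -AC A0 mul0r.
  by exists 1, 0; rewrite A0 B0 !mul0r !mulr0 addr0 oner_eq0; split => //; left.
by exists (- B), A; split; [right|ring|rewrite (mulrC C) AC; ring].
Qed.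

(* The middle triple says [x x^T + z z^T = g^-1] for [g = I + Du Du^T], that is,
   [g]-orthonormality of [(x, z)] read on covectors. *)
Lemma principal_frame (R : rcfType) (p q r s t W L : R) :
  0 < W -> W ^+ 2 = 1 + p ^+ 2 + q ^+ 2 ->
  W ^+ 2 * (L * W) ^+ 2
    - ((1 + q ^+ 2) * r - 2 * (p * q) * s + (1 + p ^+ 2) * t) * (L * W)
    + (r * t - s ^+ 2) = 0 ->
  exists x1 x2 z1 z2 : R,
  [/\ x1 ^+ 2 + x2 ^+ 2 + (p * x1 + q * x2) ^+ 2 = 1 /\
      z1 ^+ 2 + z2 ^+ 2 + (p * z1 + q * z2) ^+ 2 = 1,
    [/\ W ^+ 2 * (x1 ^+ 2 + z1 ^+ 2) = 1 + q ^+ 2,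
      W ^+ 2 * (x1 * x2 + z1 * z2) = - (p * q) &
      W ^+ 2 * (x2 ^+ 2 + z2 ^+ 2) = 1 + p ^+ 2],
    r * x1 ^+ 2 + 2 * s * x1 * x2 + t * x2 ^+ 2 = W * L &
    r * x1 * z1 + s * (x1 * z2 + x2 * z1) + t * x2 * z2 = 0].
Proof.
move=> W0 hW root.
have nW := lt0r_neq0 W0.
pose l := L * W; rewrite -/l in root.
(* The root condition says that l g - D^2u is singular; a kernel vector is a principal direction. *)
have AC : (l * (1 + p ^+ 2) - r) * (l * (1 + q ^+ 2) - t) = (l * (p * q) - s) ^+ 2.
  apply/eqP; rewrite -subr_eq0 -[X in _ == X]root; apply/eqP; rewrite hW; ring.
have [x [y [xy0 k1 k2]]] := kernel_vector AC.
pose n2 := x ^+ 2 + y ^+ 2 + (p * x + q * y) ^+ 2.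
have n20 : 0 < n2.
  rewrite /n2 ltr_pwDl ?sqr_ge0//; case: xy0 => h.
    by rewrite ltr_pwDl ?sqr_ge0// exprn_even_gt0.
  by rewrite ltr_wpDl ?sqr_ge0// exprn_even_gt0.
pose n := Num.sqrt n2; have n0 : 0 < n by rewrite sqrtr_gt0.
have nn : n ^+ 2 = x ^+ 2 + y ^+ 2 + (p * x + q * y) ^+ 2 by rewrite sqr_sqrtr// ltW.
have nn0 := lt0r_neq0 n0.
pose x1 := x / n; pose x2 := y / n.
have u1 : x1 ^+ 2 + x2 ^+ 2 + (p * x1 + q * x2) ^+ 2 = 1.
  have -> : x1 ^+ 2 + x2 ^+ 2 + (p * x1 + q * x2) ^+ 2 =
    (x ^+ 2 + y ^+ 2 + (p * x + q * y) ^+ 2) / n ^+ 2 by rewrite /x1 /x2; field.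
  by rewrite nn divff// -nn expf_eq0.
have e1 : r * x1 + s * x2 = l * ((1 + p ^+ 2) * x1 + p * q * x2).
  have -> : r * x1 + s * x2 = l * ((1 + p ^+ 2) * x1 + p * q * x2) -
    ((l * (1 + p ^+ 2) - r) * x + (l * (p * q) - s) * y) / n by rewrite /x1 /x2; field.
  by rewrite k1 mul0r subr0.
have e2 : s * x1 + t * x2 = l * (p * q * x1 + (1 + q ^+ 2) * x2).
  have -> : s * x1 + t * x2 = l * (p * q * x1 + (1 + q ^+ 2) * x2) -
    ((l * (p * q) - s) * x + (l * (1 + q ^+ 2) - t) * y) / n by rewrite /x1 /x2; field.
  by rewrite k2 mul0r subr0.
(* [z] is [x] turned by a right angle in the metric: the covector g x is rotated and divided by [W],
   the square root of det g. *)
pose z1 := - (p * q * x1 + (1 + q ^+ 2) * x2) / W.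
pose z2 := ((1 + p ^+ 2) * x1 + p * q * x2) / W.
have W2n : W ^+ 2 != 0 by rewrite expf_eq0.
have Wz1 : W ^+ 2 * z1 ^+ 2 = (p * q * x1 + (1 + q ^+ 2) * x2) ^+ 2 by rewrite /z1; field.
have Wz2 : W ^+ 2 * z2 ^+ 2 = ((1 + p ^+ 2) * x1 + p * q * x2) ^+ 2 by rewrite /z2; field.
have Wz12 : W ^+ 2 * (z1 * z2) =
  - ((p * q * x1 + (1 + q ^+ 2) * x2) * ((1 + p ^+ 2) * x1 + p * q * x2)).
  by rewrite /z1 /z2; field.
have c1 : W ^+ 2 * (x1 ^+ 2 + z1 ^+ 2) = 1 + q ^+ 2.
  (* Replacing the factor 1 by g(x, x) makes both sides homogeneous in [x], so the claim becomes a
     polynomial identity. *)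
  rewrite mulrDr Wz1 -[RHS]mulr1 -[X in _ = _ * X]u1 hW; ring.
have c2 : W ^+ 2 * (x2 ^+ 2 + z2 ^+ 2) = 1 + p ^+ 2.
  rewrite mulrDr Wz2 -[RHS]mulr1 -[X in _ = _ * X]u1 hW; ring.
have c12 : W ^+ 2 * (x1 * x2 + z1 * z2) = - (p * q).
  rewrite mulrDr Wz12 -[RHS]mulr1 -[X in _ = _ * X]u1 hW; ring.
exists x1, x2, z1, z2; split; [split => //| by [] | |].
- apply: (mulfI W2n).
  have -> : W ^+ 2 * (z1 ^+ 2 + z2 ^+ 2 + (p * z1 + q * z2) ^+ 2) =
     (1 + p ^+ 2) * (W ^+ 2 * z1 ^+ 2) + (1 + q ^+ 2) * (W ^+ 2 * z2 ^+ 2)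
     + 2 * p * q * (W ^+ 2 * (z1 * z2)) by ring.
  rewrite Wz1 Wz2 Wz12 -[X in _ = _ * X]u1 hW; ring.
- have -> : r * x1 ^+ 2 + 2 * s * x1 * x2 + t * x2 ^+ 2 =
    x1 * (r * x1 + s * x2) + x2 * (s * x1 + t * x2) by ring.
  rewrite e1 e2 (mulrC W) -/l -[RHS]mulr1 -[X in _ = _ * X]u1; ring.
- have -> : r * x1 * z1 + s * (x1 * z2 + x2 * z1) + t * x2 * z2 =
    z1 * (r * x1 + s * x2) + z2 * (s * x1 + t * x2) by ring.
  by rewrite e1 e2 /z1 /z2; field.
Qed.

Lemma Wf_gt0 (R : realType) (u : R -> R -> R) a b : 0 < Wf u a b.
Proof. by rewrite sqrtr_gt0 -addrA ltr_pwDl// addr_ge0// sqr_ge0. Qed.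

Lemma Wf_sqr (R : realType) (u : R -> R -> R) a b :
  Wf u a b ^+ 2 = 1 + dx u a b ^+ 2 + dy u a b ^+ 2.
Proof. by rewrite sqr_sqrtr// -addrA addr_ge0// addr_ge0// sqr_ge0. Qed.

Lemma gauss_curvE (R : realType) (u : R -> R -> R) a b :
  gauss_curv u a b * Wf u a b ^+ 4 =
    dx (dx u) a b * dy (dy u) a b - dy (dx u) a b ^+ 2.
Proof.
rewrite /gauss_curv /weingarten.
move: (Wf_gt0 u a b) (Wf_sqr u a b).
move: (Wf u a b) (dx u a b) (dy u a b) (dx (dx u) a b) (dy (dx u) a b) (dy (dy u) a b).
move=> W p q r s t /lt0r_neq0 nW hW.
transitivity ((r * t - s ^+ 2) * (1 + p ^+ 2 + q ^+ 2) / W ^+ 2); first by field.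
by rewrite -hW; field.
Qed.

Lemma mean_traceE (R : realType) (u : R -> R -> R) a b :
  mean_trace u a b * Wf u a b ^+ 3 =
    (1 + dy u a b ^+ 2) * dx (dx u) a b - 2 * (dx u a b * dy u a b) * dy (dx u) a b
    + (1 + dx u a b ^+ 2) * dy (dy u) a b.
Proof.
rewrite /mean_trace /weingarten; move: (lt0r_neq0 (Wf_gt0 u a b)).
move: (Wf u a b) (dx u a b) (dy u a b) (dx (dx u) a b) (dy (dx u) a b) (dy (dy u) a b).
by move=> W p q r s t nW; field.
Qed.

Lemma metric_det (R : realType) (u : R -> R -> R) a b :
  (1 + dx u a b ^+ 2) * (1 + dy u a b ^+ 2) - (dx u a b * dy u a b) ^+ 2 = Wf u a b ^+ 2.
Proof. rewrite Wf_sqr; ring. Qed.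

Lemma curvature_discriminant (R : realType) (u : R -> R -> R) a b :
  0 <= mean_trace u a b ^+ 2 - 4 * gauss_curv u a b.
Proof.
have W0 := Wf_gt0 u a b.
have E0 : 0 < 1 + dx u a b ^+ 2 by rewrite ltr_pwDl// sqr_ge0.
have D0 : 0 < (1 + dx u a b ^+ 2) * (1 + dy u a b ^+ 2) - (dx u a b * dy u a b) ^+ 2.
  by rewrite metric_det exprn_gt0.
have := pencil_discriminant (dx (dx u) a b) (dy (dx u) a b) (dy (dy u) a b) E0 D0.
rewrite -mean_traceE -gauss_curvE metric_det.
have -> : (mean_trace u a b * Wf u a b ^+ 3) ^+ 2 -
  4 * Wf u a b ^+ 2 * (gauss_curv u a b * Wf u a b ^+ 4) =
  Wf u a b ^+ 6 * (mean_trace u a b ^+ 2 - 4 * gauss_curv u a b) by ring.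
by rewrite pmulr_rge0// exprn_gt0.
Qed.

Lemma Lambda_lambda1 (R : realType) (u : R -> R -> R) a b :
  Lambda u a b = lambda1 u a b.
Proof.
apply/max_idPl; rewrite /lambda1 /lambda2 ler_pM2r ?invr_gt0//.
by rewrite lerD2l ge0_cp// sqrtr_ge0.
Qed.

Lemma Lambda_root (R : realType) (u : R -> R -> R) a b :
  Lambda u a b ^+ 2 - mean_trace u a b * Lambda u a b + gauss_curv u a b = 0.
Proof.
rewrite Lambda_lambda1 /lambda1.
have := sqr_sqrtr (curvature_discriminant u a b).
move: (Num.sqrt (mean_trace u a b ^+ 2 - 4 * gauss_curv u a b)) => S.
move: (mean_trace u a b) (gauss_curv u a b) => H K SE.
have -> : ((H + S) / 2) ^+ 2 - H * ((H + S) / 2) + K = (S ^+ 2 - (H ^+ 2 - 4 * K)) / 4.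
  by field.
by rewrite SE subrr mul0r.
Qed.

(** The characteristic equation of the Weingarten matrix, cleared of denominators: det (l g - D^2u)
    = 0 at l = [Lambda * W]. *)
Lemma Lambda_pencil (R : realType) (u : R -> R -> R) a b :
  let W := Wf u a b in
  W ^+ 2 * (Lambda u a b * W) ^+ 2
    - ((1 + dy u a b ^+ 2) * dx (dx u) a b - 2 * (dx u a b * dy u a b) * dy (dx u) a b
       + (1 + dx u a b ^+ 2) * dy (dy u) a b) * (Lambda u a b * W)
    + (dx (dx u) a b * dy (dy u) a b - dy (dx u) a b ^+ 2) = 0.
Proof.
move=> W; rewrite -mean_traceE -gauss_curvE -/W.
rewrite -(mulr0 (W ^+ 4)) -(Lambda_root u a b); ring.
Qed.

(** The trace hypothesis puts [l] at or above the mean of the two roots, so it is the larger one.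
    Then l g - D^2u is degenerate with nonnegative trace, hence nonnegative. *)
Lemma pencil_form_le (R : realFieldType) (p q r s t W l : R) :
  W ^+ 2 = 1 + p ^+ 2 + q ^+ 2 ->
  W ^+ 2 * l ^+ 2
    - ((1 + q ^+ 2) * r - 2 * (p * q) * s + (1 + p ^+ 2) * t) * l
    + (r * t - s ^+ 2) = 0 ->
  (1 + q ^+ 2) * r - 2 * (p * q) * s + (1 + p ^+ 2) * t <= 2 * (W ^+ 2 * l) ->
  forall x y, r * x ^+ 2 + 2 * s * x * y + t * y ^+ 2 <=
    l * (x ^+ 2 + y ^+ 2 + (p * x + q * y) ^+ 2).
Proof.
move=> hW pen tr x y.
have E0 : 0 < 1 + p ^+ 2 by rewrite ltr_pwDl// sqr_ge0.
have D0 : 0 < (1 + p ^+ 2) * (1 + q ^+ 2) - (p * q) ^+ 2.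
  have -> : (1 + p ^+ 2) * (1 + q ^+ 2) - (p * q) ^+ 2 = 1 + p ^+ 2 + q ^+ 2 by ring.
  by rewrite ltr_wpDr// sqr_ge0.
have AC : (l * (1 + p ^+ 2) - r) * (l * (1 + q ^+ 2) - t) = (l * (p * q) - s) ^+ 2.
  apply/eqP; rewrite -subr_eq0 -[X in _ == X]pen; apply/eqP; rewrite hW; ring.
have tr' : 0 <= (1 + q ^+ 2) * (l * (1 + p ^+ 2) - r)
    - 2 * (p * q) * (l * (p * q) - s) + (1 + p ^+ 2) * (l * (1 + q ^+ 2) - t).
  move: tr; rewrite -subr_ge0 hW => /(etrans _); apply; congr (_ <= _); ring.
have := degenerate_form_ge0 E0 D0 AC tr' x y.
move=> h; rewrite -subr_ge0; apply: etrans h; congr (_ <= _); ring.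
Qed.

(** This replaces [Lambda], which may fail to be differentiable at umbilics, by the smooth second
    fundamental form on a test vector. *)
Lemma second_form_le (R : realType) (u : R -> R -> R) a b x y :
  dx (dx u) a b * x ^+ 2 + 2 * dy (dx u) a b * x * y + dy (dy u) a b * y ^+ 2 <=
  Lambda u a b * Wf u a b * (x ^+ 2 + y ^+ 2 + (dx u a b * x + dy u a b * y) ^+ 2).
Proof.
have W0 := Wf_gt0 u a b.
apply: (pencil_form_le (Wf_sqr u a b) (Lambda_pencil u a b)).
rewrite -mean_traceE.
have -> : 2 * (Wf u a b ^+ 2 * (Lambda u a b * Wf u a b)) =
  (2 * Lambda u a b) * Wf u a b ^+ 3.
  by move: (Wf u a b) (Lambda u a b) => W L; ring.
rewrite ler_pM2r ?exprn_gt0// Lambda_lambda1 /lambda1 mulrC divfK//.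
by rewrite lerDl sqrtr_ge0.
Qed.

(** * The second derivative tests *)

Lemma slope_jet (R : realType) (p q : R -> R) (p0 p1 p2 q0 q1 q2 W w1 w2 : R) :
  jet2 p p0 p1 p2 -> jet2 q q0 q1 q2 ->
  0 < W -> W ^+ 2 = 1 + p0 ^+ 2 + q0 ^+ 2 -> W * w1 = p0 * p1 + q0 * q1 ->
  w1 ^+ 2 + W * w2 = p1 ^+ 2 + q1 ^+ 2 + (p0 * p2 + q0 * q2) ->
  jet2 (fun s => Num.sqrt (1 + p s ^+ 2 + q s ^+ 2)) W w1 w2.
Proof.
move=> jp jq W0 hW h1 h2.
have j := jet2_add (jet2_add (jet2_cst 1) (jet2_mul jp jp)) (jet2_mul jq jq).
have := jet2_sqrt (w0 := W) (w1 := w1) (w2 := w2) j W0; apply.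
- by rewrite hW; ring.
- by rewrite h1; ring.
- by rewrite h2; ring.
Qed.

(** For a graph, K = c <n, e3> reads det D^2u = c W^3; the two conclusions are its first and second
    derivatives along a line. *)
Lemma equation_jet (R : realType) (r s t w : R -> R)
    (r0 r1 r2 s0 s1 s2 t0 t1 t2 W w1 w2 c : R) :
  jet2 r r0 r1 r2 -> jet2 s s0 s1 s2 -> jet2 t t0 t1 t2 -> jet2 w W w1 w2 ->
  (\forall x \near (0 : R), r x * t x - s x ^+ 2 = c * w x ^+ 3) ->
  r0 * t1 + r1 * t0 - 2 * s0 * s1 = 3 * c * W ^+ 2 * w1 /\
  r0 * t2 + 2 * r1 * t1 + r2 * t0 - 2 * s0 * s2 - 2 * s1 ^+ 2 =
    c * (6 * W * w1 ^+ 2 + 3 * W ^+ 2 * w2).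
Proof.
move=> jr js jt jw eqn.
have jl := jet2_sub (jet2_mul jr jt) (jet2_mul js js).
have jR := jet2_scale c (jet2_mul jw (jet2_mul jw jw)).
have eqn' : \forall x \near (0 : R), r x * t x - s x * s x = c * (w x * (w x * w x)).
  by apply: filterS eqn => x; rewrite expr2 exprS expr2.
have [_ E1 E2] := jet2_unique eqn' jl jR.
split; first by transitivity (r0 * t1 + r1 * t0 - (s0 * s1 + s1 * s0));
  [ring|rewrite E1; ring].
transitivity (r0 * t2 + 2 * r1 * t1 + r2 * t0 - (s0 * s2 + 2 * s1 * s1 + s2 * s0)).
  by ring.
by rewrite E2; ring.
Qed.

(* The test vector [v(x) = y - x k Du(0)] is, for a suitable rate [k], parallel
   to first order along the line. *)
Lemma test_jet (R : realType) (h p q r s t w : R -> R)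
    (e0 e1 e2 p0 p1 p2 q0 q1 q2 r0 r1 r2 s0 s1 s2 t0 t1 t2 W w1 w2 y1 y2 k m
     H0 H1 H2 l0 l1 l2 G0 G1 G2 : R) :
  jet2 h e0 e1 e2 -> jet2 p p0 p1 p2 -> jet2 q q0 q1 q2 ->
  jet2 r r0 r1 r2 -> jet2 s s0 s1 s2 -> jet2 t t0 t1 t2 -> jet2 w W w1 w2 ->
  (\forall x \near (0 : R), forall v1 v2 : R,
     h x * (r x * v1 ^+ 2 + 2 * s x * v1 * v2 + t x * v2 ^+ 2) <=
     m * (w x * (v1 ^+ 2 + v2 ^+ 2 + (p x * v1 + q x * v2) ^+ 2))) ->
  r0 * y1 ^+ 2 + 2 * s0 * y1 * y2 + t0 * y2 ^+ 2 = H0 ->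
  r1 * y1 ^+ 2 + 2 * s1 * y1 * y2 + t1 * y2 ^+ 2 -
    2 * k * (r0 * y1 * p0 + s0 * (y1 * q0 + y2 * p0) + t0 * y2 * q0) = H1 ->
  r2 * y1 ^+ 2 + 2 * s2 * y1 * y2 + t2 * y2 ^+ 2 -
    4 * k * (r1 * y1 * p0 + s1 * (y1 * q0 + y2 * p0) + t1 * y2 * q0) +
    2 * k ^+ 2 * (r0 * p0 ^+ 2 + 2 * s0 * p0 * q0 + t0 * q0 ^+ 2) = H2 ->
  p0 * y1 + q0 * y2 = l0 ->
  p1 * y1 + q1 * y2 - k * (p0 ^+ 2 + q0 ^+ 2) = l1 ->
  p2 * y1 + q2 * y2 - 2 * k * (p0 * p1 + q0 * q1) = l2 ->
  y1 ^+ 2 + y2 ^+ 2 + l0 ^+ 2 = G0 ->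
  2 * l0 * l1 - 2 * k * l0 = G1 ->
  2 * k ^+ 2 * (p0 ^+ 2 + q0 ^+ 2) + 2 * l1 ^+ 2 + 2 * l0 * l2 = G2 ->
  e0 * H0 = m * (W * G0) ->
  e0 * H1 + e1 * H0 - m * (W * G1 + w1 * G0) = 0 /\
  e0 * H2 + 2 * e1 * H1 + e2 * H0 - m * (W * G2 + 2 * w1 * G1 + w2 * G0) <= 0.
Proof.
move=> jh jp jq jr js jt jw mx H0E H1E H2E l0E l1E l2E G0E G1E G2E touch.
have jv1 : jet2 (fun x => y1 - k * p0 * x) y1 (- (k * p0)) 0.
  by apply: jet2_val (jet2_sub (jet2_cst y1) (jet2_scale (k * p0) (jet2_id R))) _ _ _; ring.
have jv2 : jet2 (fun x => y2 - k * q0 * x) y2 (- (k * q0)) 0.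
  by apply: jet2_val (jet2_sub (jet2_cst y2) (jet2_scale (k * q0) (jet2_id R))) _ _ _; ring.
(* [H], [l] and [G] carry the jets of D^2u(v, v), <Du, v> and g(v, v). *)
have jH := jet2_add (jet2_add (jet2_mul jr (jet2_mul jv1 jv1))
   (jet2_scale 2 (jet2_mul js (jet2_mul jv1 jv2)))) (jet2_mul jt (jet2_mul jv2 jv2)).
have {}jH := jet2_val (b0 := H0) (b1 := H1) (b2 := H2) jH
  ltac:(rewrite -H0E; ring) ltac:(rewrite -H1E; ring) ltac:(rewrite -H2E; ring).
have jl := jet2_add (jet2_mul jp jv1) (jet2_mul jq jv2).
have {}jl := jet2_val (b0 := l0) (b1 := l1) (b2 := l2) jl
  ltac:(rewrite -l0E; ring) ltac:(rewrite -l1E; ring) ltac:(rewrite -l2E; ring).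
have jG := jet2_add (jet2_add (jet2_mul jv1 jv1) (jet2_mul jv2 jv2)) (jet2_mul jl jl).
have {}jG := jet2_val (b0 := G0) (b1 := G1) (b2 := G2) jG
  ltac:(rewrite -G0E; ring) ltac:(rewrite -G1E -l0E; ring) ltac:(rewrite -G2E; ring).
have j := jet2_sub (jet2_mul jh jH) (jet2_scale m (jet2_mul jw jG)).
have neg : \forall x \near (0 : R), h x *
    (r x * ((y1 - k * p0 * x) * (y1 - k * p0 * x)) +
     2 * (s x * ((y1 - k * p0 * x) * (y2 - k * q0 * x))) +
     t x * ((y2 - k * q0 * x) * (y2 - k * q0 * x))) -
    m * (w x * ((y1 - k * p0 * x) * (y1 - k * p0 * x) +
      (y2 - k * q0 * x) * (y2 - k * q0 * x) +
      (p x * (y1 - k * p0 * x) + q x * (y2 - k * q0 * x)) *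
      (p x * (y1 - k * p0 * x) + q x * (y2 - k * q0 * x)))) <= 0.
  apply: filterS mx => x /(_ (y1 - k * p0 * x) (y2 - k * q0 * x)).
  rewrite -subr_le0; apply: etrans; congr (_ <= _); ring.
have [] := jet2_max neg j; first by rewrite touch subrr.
move=> E1 E2; split; first by rewrite -[RHS]E1; ring.
apply: le_trans E2; rewrite le_eqVlt; apply/orP; left; apply/eqP; ring.
Qed.

(* [d i j] is the partial derivative d^(i+j) u / dx^i dy^j at the maximum point;
   [F] and [G] restrict these derivatives to the lines through that point in the
   principal directions [x] and [z]. *)
Lemma frame_estimate (R : realType) (d : nat -> nat -> R) (F G : nat -> nat -> R -> R)
    (x1 x2 z1 z2 A B Y R2 W L c e rho : R) :
  0 < W -> W ^+ 2 = 1 + d 1%N 0%N ^+ 2 + d 0%N 1%N ^+ 2 ->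
  [/\ x1 ^+ 2 + x2 ^+ 2 + (d 1%N 0%N * x1 + d 0%N 1%N * x2) ^+ 2 = 1 /\
      z1 ^+ 2 + z2 ^+ 2 + (d 1%N 0%N * z1 + d 0%N 1%N * z2) ^+ 2 = 1,
    [/\ W ^+ 2 * (x1 ^+ 2 + z1 ^+ 2) = 1 + d 0%N 1%N ^+ 2,
      W ^+ 2 * (x1 * x2 + z1 * z2) = - (d 1%N 0%N * d 0%N 1%N) &
      W ^+ 2 * (x2 ^+ 2 + z2 ^+ 2) = 1 + d 1%N 0%N ^+ 2],
    d 2%N 0%N * x1 ^+ 2 + 2 * d 1%N 1%N * x1 * x2 + d 0%N 2%N * x2 ^+ 2 = W * L &
    d 2%N 0%N * x1 * z1 + d 1%N 1%N * (x1 * z2 + x2 * z1) + d 0%N 2%N * x2 * z2 = 0] ->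
  (forall i j, jet2 (F i j) (d i j) (x1 * d i.+1 j + x2 * d i j.+1)
    (x1 ^+ 2 * d i.+2 j + 2 * x1 * x2 * d i.+1 j.+1 + x2 ^+ 2 * d i j.+2)) ->
  (forall i j, jet2 (G i j) (d i j) (z1 * d i.+1 j + z2 * d i j.+1)
    (z1 ^+ 2 * d i.+2 j + 2 * z1 * z2 * d i.+1 j.+1 + z2 ^+ 2 * d i j.+2)) ->
  (\forall s \near (0 : R), F 2%N 0%N s * F 0%N 2%N s - F 1%N 1%N s ^+ 2 =
     c * Num.sqrt (1 + F 1%N 0%N s ^+ 2 + F 0%N 1%N s ^+ 2) ^+ 3) ->
  (\forall s \near (0 : R), G 2%N 0%N s * G 0%N 2%N s - G 1%N 1%N s ^+ 2 =
     c * Num.sqrt (1 + G 1%N 0%N s ^+ 2 + G 0%N 1%N s ^+ 2) ^+ 3) ->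
  (\forall s \near (0 : R), forall v1 v2 : R,
     ((A + s * x1) ^+ 2 + (B + s * x2) ^+ 2 + (F 0%N 0%N s - Y) ^+ 2 - R2) *
       (F 2%N 0%N s * v1 ^+ 2 + 2 * F 1%N 1%N s * v1 * v2 + F 0%N 2%N s * v2 ^+ 2) <=
     e * L * (Num.sqrt (1 + F 1%N 0%N s ^+ 2 + F 0%N 1%N s ^+ 2) *
       (v1 ^+ 2 + v2 ^+ 2 + (F 1%N 0%N s * v1 + F 0%N 1%N s * v2) ^+ 2))) ->
  (\forall s \near (0 : R), forall v1 v2 : R,
     ((A + s * z1) ^+ 2 + (B + s * z2) ^+ 2 + (G 0%N 0%N s - Y) ^+ 2 - R2) *
       (G 2%N 0%N s * v1 ^+ 2 + 2 * G 1%N 1%N s * v1 * v2 + G 0%N 2%N s * v2 ^+ 2) <=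
     e * L * (Num.sqrt (1 + G 1%N 0%N s ^+ 2 + G 0%N 1%N s ^+ 2) *
       (v1 ^+ 2 + v2 ^+ 2 + (G 1%N 0%N s * v1 + G 0%N 1%N s * v2) ^+ 2))) ->
  0 < L -> 0 < c -> 0 < e -> 0 <= rho ->
  rho ^+ 2 = A ^+ 2 + B ^+ 2 + (d 0%N 0%N - Y) ^+ 2 -> e = rho ^+ 2 - R2 -> 0 <= R2 ->
  d 2%N 0%N * d 0%N 2%N - d 1%N 1%N ^+ 2 = c * W ^+ 3 ->
  e * L <= 9 / 2 * c * rho ^+ 3.
Proof.
move=> W0 hW [[nx nz] [c11 c12 c22] hxx hxz] jF jG eF eG mF mG L0 c0 e0 rho0 hrho he R20 eq0.
have nW := lt0r_neq0 W0; have nL := lt0r_neq0 L0.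
have nW2 : W ^+ 2 != 0 by rewrite expf_eq0.
have [jF00 jF10 jF01 jF20 jF11] := And5 (jF 0 0)%N (jF 1 0)%N (jF 0 1)%N (jF 2 0)%N (jF 1 1)%N.
have jF02 := jF 0%N 2%N.
have [jG00 jG10 jG01 jG20 jG11] := And5 (jG 0 0)%N (jG 1 0)%N (jG 0 1)%N (jG 2 0)%N (jG 1 1)%N.
have jG02 := jG 0%N 2%N.
move: (F 0 0)%N (F 1 0)%N (F 0 1)%N (F 2 0)%N (F 1 1)%N (F 0 2)%N jF00 jF10 jF01 jF20 jF11 jF02 eF mF.
move=> U0 U1 U2 U3 U4 U5 jU0 jU1 jU2 jU3 jU4 jU5 eU mU.
move: (G 0 0)%N (G 1 0)%N (G 0 1)%N (G 2 0)%N (G 1 1)%N (G 0 2)%N jG00 jG10 jG01 jG20 jG11 jG02 eG mG.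
move=> V0 V1 V2 V3 V4 V5 jV0 jV1 jV2 jV3 jV4 jV5 eV mV.
clear F G jF jG.
move: (d 0 0)%N (d 1 0)%N (d 0 1)%N (d 2 0)%N (d 1 1)%N (d 0 2)%N (d 3 0)%N (d 2 1)%N (d 1 2)%N
  (d 0 3)%N (d 4 0)%N (d 3 1)%N (d 2 2)%N (d 1 3)%N (d 0 4)%N hW nx nz  c11 c12 c22 hxx hxz hrho eq0
  jU0 jU1 jU2 jU3 jU4 jU5 jV0 jV1 jV2 jV3 jV4 jV5.
move=> u p q r s t d30 d21 d12 d03 d40 d31 d22 d13 d04 hW nx nz  c11 c12 c22 hxx hxz hrho eq0
  jU0 jU1 jU2 jU3 jU4 jU5 jV0 jV1 jV2 jV3 jV4 jV5.
(* [P1] and [P2] are the components of e3 along the frame; [l2] is the second principal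
   curvature. *)
pose P1 := p * x1 + q * x2; pose P2 := p * z1 + q * z2.
pose l2 := (r * z1 ^+ 2 + 2 * s * z1 * z2 + t * z2 ^+ 2) / W.
have hzz : r * z1 ^+ 2 + 2 * s * z1 * z2 + t * z2 ^+ 2 = W * l2 by rewrite /l2; field.
(* The matrix g^-1 = x x^T + z z^T sends Du to Du / W^2, so a pairing with Du can be read in frame
   coordinates. *)
have dotE f g : p * f + q * g = W ^+ 2 * (P1 * (x1 * f + x2 * g) + P2 * (z1 * f + z2 * g)).
  have -> : W ^+ 2 * (P1 * (x1 * f + x2 * g) + P2 * (z1 * f + z2 * g)) =
     f * (p * (W ^+ 2 * (x1 ^+ 2 + z1 ^+ 2)) + q * (W ^+ 2 * (x1 * x2 + z1 * z2))) +
     g * (p * (W ^+ 2 * (x1 * x2 + z1 * z2)) + q * (W ^+ 2 * (x2 ^+ 2 + z2 ^+ 2))).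
    by rewrite /P1 /P2; ring.
  by rewrite c11 c12 c22; ring.
(* The identity I = g^-1 + Du Du^T / W^2, evaluated on a covector. *)
have sqE f g : f ^+ 2 + g ^+ 2 = (x1 * f + x2 * g) ^+ 2 + (z1 * f + z2 * g) ^+ 2 +
    (p * f + q * g) ^+ 2 / W ^+ 2.
  apply: (mulfI nW2).
  have -> : W ^+ 2 * ((x1 * f + x2 * g) ^+ 2 + (z1 * f + z2 * g) ^+ 2 +
      (p * f + q * g) ^+ 2 / W ^+ 2) =
    f ^+ 2 * (W ^+ 2 * (x1 ^+ 2 + z1 ^+ 2)) + 2 * f * g * (W ^+ 2 * (x1 * x2 + z1 * z2)) +
    g ^+ 2 * (W ^+ 2 * (x2 ^+ 2 + z2 ^+ 2)) + (p * f + q * g) ^+ 2 by field.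
  by rewrite c11 c12 c22 hW; ring.
have hP : W ^+ 2 * (P1 ^+ 2 + P2 ^+ 2) = W ^+ 2 - 1.
  have <- : p * p + q * q = W ^+ 2 - 1 by rewrite hW; ring.
  by rewrite (dotE p q) /P1 /P2; ring.
have dets : W ^+ 2 * (x1 * z2 - x2 * z1) ^+ 2 = 1.
  apply: (mulfI nW2).
  have -> : W ^+ 2 * (W ^+ 2 * (x1 * z2 - x2 * z1) ^+ 2) =
    (W ^+ 2 * (x1 ^+ 2 + z1 ^+ 2)) * (W ^+ 2 * (x2 ^+ 2 + z2 ^+ 2)) -
    (W ^+ 2 * (x1 * x2 + z1 * z2)) ^+ 2 by ring.
  by rewrite c11 c12 c22 hW; ring.
have ll : L * l2 = c / W.
  have E : (W * L) * (W * l2) * W ^+ 2 = c * W ^+ 3.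
    rewrite -hxx -hzz -eq0 -[RHS]mulr1 -[X in _ = _ * X]dets.
    have -> : (r * x1 ^+ 2 + 2 * s * x1 * x2 + t * x2 ^+ 2) *
       (r * z1 ^+ 2 + 2 * s * z1 * z2 + t * z2 ^+ 2) =
       (r * t - s ^+ 2) * (x1 * z2 - x2 * z1) ^+ 2 +
       (r * x1 * z1 + s * (x1 * z2 + x2 * z1) + t * x2 * z2) ^+ 2 by ring.
    by rewrite hxz; ring.
  have -> : c = (W * L) * (W * l2) * W ^+ 2 / W ^+ 3 by rewrite E; field.
  by field.
have l20 : 0 < l2 by rewrite -(pmulr_rgt0 _ L0) ll divr_gt0.
(* [(px, qx)] and [(pz, qz)] are the derivatives of Du along [x] and [z]; the frame diagonalises
   D^2u. *)
pose px := x1 * r + x2 * s; pose qx := x1 * s + x2 * t.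
pose pz := z1 * r + z2 * s; pose qz := z1 * s + z2 * t.
have dx1 : x1 * px + x2 * qx = W * L by rewrite -hxx /px /qx; ring.
have dx2 : z1 * px + z2 * qx = 0 by rewrite -hxz /px /qx; ring.
have dz1 : x1 * pz + x2 * qz = 0 by rewrite -hxz /pz /qz; ring.
have dz2 : z1 * pz + z2 * qz = W * l2 by rewrite -hzz /pz /qz; ring.
have Dx : p * px + q * qx = W ^+ 3 * P1 * L by rewrite dotE dx1 dx2; ring.
have Dz : p * pz + q * qz = W ^+ 3 * P2 * l2 by rewrite dotE dz1 dz2; ring.
pose pxx := x1 ^+ 2 * d30 + 2 * x1 * x2 * d21 + x2 ^+ 2 * d12.
pose qxx := x1 ^+ 2 * d21 + 2 * x1 * x2 * d12 + x2 ^+ 2 * d03.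
pose pzz := z1 ^+ 2 * d30 + 2 * z1 * z2 * d21 + z2 ^+ 2 * d12.
pose qzz := z1 ^+ 2 * d21 + 2 * z1 * z2 * d12 + z2 ^+ 2 * d03.
(* The indices of [T] and, later, of [Q] count frame arguments of D^3u and D^4u: 1 stands for [x], 2
   for [z]. *)
pose T111 := x1 * pxx + x2 * qxx; pose T112 := z1 * pxx + z2 * qxx.
pose T122 := x1 * pzz + x2 * qzz; pose T222 := z1 * pzz + z2 * qzz.
have Dxx : p * pxx + q * qxx = W ^+ 2 * (P1 * T111 + P2 * T112) by rewrite dotE.
have Dzz : p * pzz + q * qzz = W ^+ 2 * (P1 * T122 + P2 * T222) by rewrite dotE.
have D3 : r * p ^+ 2 + 2 * s * p * q + t * q ^+ 2 = W ^+ 5 * (P1 ^+ 2 * L + P2 ^+ 2 * l2).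
  have -> : r * p ^+ 2 + 2 * s * p * q + t * q ^+ 2 = p * (r * p + s * q) + q * (s * p + t * q).
    by ring.
  rewrite dotE.
  have -> : x1 * (r * p + s * q) + x2 * (s * p + t * q) = p * px + q * qx by rewrite /px /qx; ring.
  have -> : z1 * (r * p + s * q) + z2 * (s * p + t * q) = p * pz + q * qz by rewrite /pz /qz; ring.
  by rewrite Dx Dz; ring.
have jWU : jet2 (fun a => Num.sqrt (1 + U1 a ^+ 2 + U2 a ^+ 2)) W (W ^+ 2 * P1 * L)
    (W * L ^+ 2 + W * (P1 * T111 + P2 * T112)).
  apply: (slope_jet jU1 jU2) => //; rewrite -/px -/qx; first by rewrite Dx; ring.
  rewrite -/pxx -/qxx Dxx sqE dx1 dx2 Dx; field.
  exact: nW.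
have jWV : jet2 (fun a => Num.sqrt (1 + V1 a ^+ 2 + V2 a ^+ 2)) W (W ^+ 2 * P2 * l2)
    (W * l2 ^+ 2 + W * (P1 * T122 + P2 * T222)).
  apply: (slope_jet jV1 jV2) => //; rewrite -/pz -/qz; first by rewrite Dz; ring.
  rewrite -/pzz -/qzz Dzz sqE dz1 dz2 Dz; field.
  exact: nW.
pose X3 := u - Y.
pose f1 := A * x1 + B * x2 + X3 * P1; pose f2 := A * z1 + B * z2 + X3 * P2.
have jaff (k0 k1 : R) : jet2 (fun a => k0 + a * k1) k0 k1 0.
  have := jet2_add (jet2_cst k0) (jet2_mul (jet2_id R) (jet2_cst k1)).
  by move/jet2_val; apply; ring.
(* On a straight line in the parameter domain only the height accelerates, by D^2u(x, x) = W L; the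
   constant 2 comes from g(x, x) = 1. *)
have jhU : jet2 (fun a => (A + a * x1) ^+ 2 + (B + a * x2) ^+ 2 + (U0 a - Y) ^+ 2 - R2)
   e (2 * f1) (2 + 2 * X3 * W * L).
  have jY := jet2_sub jU0 (jet2_cst Y).
  have := jet2_sub (jet2_add (jet2_add (jet2_mul (jaff A x1) (jaff A x1))
    (jet2_mul (jaff B x2) (jaff B x2))) (jet2_mul jY jY)) (jet2_cst R2).
  move/jet2_val; apply.
  - by rewrite he hrho; ring.
  - by rewrite /f1 /P1 /X3; ring.
  - have -> : 2 * X3 * W * L = 2 * X3 * (W * L) by ring.
    by rewrite -hxx -[X in _ = X + _]mulr1 -[X in _ = _ * X + _]nx /X3; ring.
have jhV : jet2 (fun a => (A + a * z1) ^+ 2 + (B + a * z2) ^+ 2 + (V0 a - Y) ^+ 2 - R2)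
   e (2 * f2) (2 + 2 * X3 * W * l2).
  have jY := jet2_sub jV0 (jet2_cst Y).
  have := jet2_sub (jet2_add (jet2_add (jet2_mul (jaff A z1) (jaff A z1))
    (jet2_mul (jaff B z2) (jaff B z2))) (jet2_mul jY jY)) (jet2_cst R2).
  move/jet2_val; apply.
  - by rewrite he hrho; ring.
  - by rewrite /f2 /P2 /X3; ring.
  - have -> : 2 * X3 * W * l2 = 2 * X3 * (W * l2) by ring.
    by rewrite -hzz -[X in _ = X + _]mulr1 -[X in _ = _ * X + _]nz /X3; ring.
(* The third term is <X, n>^2 for X = F - Y, so this is Pythagoras in the frame. *)
have norm : f1 ^+ 2 + f2 ^+ 2 + (W * (X3 - P1 * f1 - P2 * f2)) ^+ 2 = rho ^+ 2.
  pose al := A + X3 * p; pose be := B + X3 * q.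
  have f1E : x1 * al + x2 * be = f1 by rewrite /f1 /al /be /P1; ring.
  have f2E : z1 * al + z2 * be = f2 by rewrite /f2 /al /be /P2; ring.
  have nE : W ^+ 2 * (P1 * f1 + P2 * f2) = p * al + q * be by rewrite dotE f1E f2E.
  have sE := sqE al be; rewrite f1E f2E in sE.
  have -> : (W * (X3 - P1 * f1 - P2 * f2)) ^+ 2 =
     (W ^+ 2 * X3 - W ^+ 2 * (P1 * f1 + P2 * f2)) ^+ 2 / W ^+ 2 by field.
  rewrite nE; have -> : f1 ^+ 2 + f2 ^+ 2 = al ^+ 2 + be ^+ 2 - (p * al + q * be) ^+ 2 / W ^+ 2.
    by rewrite sE addrK.
  have -> : rho ^+ 2 = (rho ^+ 2 * W ^+ 2) / W ^+ 2 by field.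
  rewrite hrho -/X3.
  have -> : al ^+ 2 + be ^+ 2 - (p * al + q * be) ^+ 2 / W ^+ 2 +
     (W ^+ 2 * X3 - (p * al + q * be)) ^+ 2 / W ^+ 2 =
     (W ^+ 2 * (al ^+ 2 + be ^+ 2) - 2 * W ^+ 2 * X3 * (p * al + q * be) + W ^+ 2 * W ^+ 2 * X3 ^+ 2) / W ^+ 2.
    by field.
  by congr (_ / _); rewrite hW /al /be; ring.
have [eq1 eq2] := equation_jet jU3 jU4 jU5 jWU eU.
have [eq3 _] := equation_jet jV3 jV4 jV5 jWV eV.
have cW : c = L * l2 * W by rewrite ll; field.
have touch : e * (r * x1 ^+ 2 + 2 * s * x1 * x2 + t * x2 ^+ 2) =
    e * L * (W * (x1 ^+ 2 + x2 ^+ 2 + (p * x1 + q * x2) ^+ 2)).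
  by rewrite hxx nx; ring.
pose r1 := x1 * d30 + x2 * d21; pose s1 := x1 * d21 + x2 * d12.
pose t1 := x1 * d12 + x2 * d03.
pose r2 := x1 ^+ 2 * d40 + 2 * x1 * x2 * d31 + x2 ^+ 2 * d22.
pose s2 := x1 ^+ 2 * d31 + 2 * x1 * x2 * d22 + x2 ^+ 2 * d13.
pose t2 := x1 ^+ 2 * d22 + 2 * x1 * x2 * d13 + x2 ^+ 2 * d04.
pose Q1111 := r2 * x1 ^+ 2 + 2 * s2 * x1 * x2 + t2 * x2 ^+ 2.
pose Q1122 := r2 * z1 ^+ 2 + 2 * s2 * z1 * z2 + t2 * z2 ^+ 2.
(* The Christoffel term for [x] along [x] is D^2u(x, x) Du / W^2 = (L / W) Du, whence the rate
   [L / W]. *)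
have [||||||||||h1 i1] := test_jet (y1 := x1) (y2 := x2) (k := L / W) (H0 := W * L)
   (H1 := T111 - 2 * W ^+ 2 * L ^+ 2 * P1)
   (H2 := Q1111 - 4 * W * L * (P1 * T111 + P2 * T112) +
        2 * W ^+ 3 * L ^+ 2 * (P1 ^+ 2 * L + P2 ^+ 2 * l2))
   (l0 := P1) (l1 := L / W) (l2 := T111 - 2 * W ^+ 2 * L ^+ 2 * P1)
   (G0 := 1) (G1 := 0) (G2 := 2 * L ^+ 2 + 2 * P1 * T111 - 4 * W ^+ 2 * L ^+ 2 * P1 ^+ 2)
   jhU jU1 jU2 jU3 jU4 jU5 jWU mU.
- exact: hxx.
- transitivity (T111 - 2 * (L / W) * (p * px + q * qx)); last by rewrite Dx; field.
  by rewrite /T111 /pxx /qxx /px /qx; ring.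
- transitivity (Q1111 - 4 * (L / W) * (p * pxx + q * qxx) +
    2 * (L / W) ^+ 2 * (r * p ^+ 2 + 2 * s * p * q + t * q ^+ 2)).
    by rewrite /Q1111 /r2 /s2 /t2 /pxx /qxx; ring.
  by rewrite D3 Dxx; field.
- by [].
- transitivity ((x1 * px + x2 * qx) - L / W * (W ^+ 2 - 1)); last by rewrite dx1; field.
  by rewrite hW /px /qx; ring.
- transitivity (T111 - 2 * (L / W) * (p * px + q * qx)); last by rewrite Dx; field.
  by rewrite /T111 /pxx /qxx /px /qx; ring.
- exact: nx.
- ring.
- have -> : p ^+ 2 + q ^+ 2 = W ^+ 2 - 1 by rewrite hW; ring.
  by field.
- by rewrite mulr1; ring.
(* Since D^2u(x, z) = 0, the Christoffel term vanishes along [z]: the constant field is already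
   parallel to first order. *)
have [||||||||||h2 i2] := test_jet (y1 := x1) (y2 := x2) (k := 0) (H0 := W * L)
   (H1 := T112) (H2 := Q1122) (l0 := P1) (l1 := 0) (l2 := T122)
   (G0 := 1) (G1 := 0) (G2 := 2 * P1 * T122)
   jhV jV1 jV2 jV3 jV4 jV5 jWV mV.
- exact: hxx.
- by rewrite /T112 /pxx /qxx; ring.
- by rewrite /Q1122 /r2 /s2 /t2; ring.
- by [].
- by rewrite -[RHS]dz1 /pz /qz; ring.
- by rewrite /T122 /pzz /qzz; ring.
- exact: nx.
- ring.
- ring.
- by rewrite mulr1; ring.
(* A polarised 2 by 2 determinant evaluated on the frame scales by the squared frame determinant,
   which [dets] identifies as 1 / W^2. The same device gives [k2] and [k3]. *)
have k1 : T111 * l2 + L * T122 = 3 * W ^+ 2 * L ^+ 2 * l2 * P1.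
  apply: (mulfI nW).
  transitivity ((x1 * z2 - x2 * z1) ^+ 2 * (r * t1 + r1 * t - 2 * s * s1)).
    transitivity ((r * x1 ^+ 2 + 2 * s * x1 * x2 + t * x2 ^+ 2) * T122 +
        T111 * (r * z1 ^+ 2 + 2 * s * z1 * z2 + t * z2 ^+ 2) -
        2 * (r * x1 * z1 + s * (x1 * z2 + x2 * z1) + t * x2 * z2) * T112).
      by rewrite hxx hzz hxz; ring.
    by rewrite /T111 /T112 /T122 /pxx /qxx /pzz /qzz /r1 /s1 /t1; ring.
  rewrite eq1 cW -[RHS]mulr1 -[X in _ = _ * X]dets; ring.
have k2 : T112 * l2 + L * T222 = 3 * W ^+ 2 * L * l2 ^+ 2 * P2.
  apply: (mulfI nW).
  transitivity ((x1 * z2 - x2 * z1) ^+ 2 * (r * (z1 * d12 + z2 * d03) +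
      (z1 * d30 + z2 * d21) * t - 2 * s * (z1 * d21 + z2 * d12))).
    transitivity ((r * x1 ^+ 2 + 2 * s * x1 * x2 + t * x2 ^+ 2) * T222 +
        T112 * (r * z1 ^+ 2 + 2 * s * z1 * z2 + t * z2 ^+ 2) -
        2 * (r * x1 * z1 + s * (x1 * z2 + x2 * z1) + t * x2 * z2) * T122).
      by rewrite hxx hzz hxz; ring.
    by rewrite /T112 /T122 /T222 /pxx /qxx /pzz /qzz; ring.
  rewrite eq3 cW -[RHS]mulr1 -[X in _ = _ * X]dets; ring.
have k3 : Q1111 * W * l2 + 2 * T111 * T122 + W * L * Q1122 - 2 * T112 ^+ 2 =
    L * l2 * (6 * W ^+ 4 * P1 ^+ 2 * L ^+ 2 + 3 * W ^+ 2 * L ^+ 2 +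
               3 * W ^+ 2 * (P1 * T111 + P2 * T112)).
  transitivity ((x1 * z2 - x2 * z1) ^+ 2 *
      (r * t2 + 2 * r1 * t1 + r2 * t - 2 * s * s2 - 2 * s1 ^+ 2)).
    (* D^4u(x, x, x, z) occurs only with the factor D^2u(x, z) = 0. *)
    transitivity ((r * x1 ^+ 2 + 2 * s * x1 * x2 + t * x2 ^+ 2) * Q1122 +
        2 * T111 * T122 + Q1111 * (r * z1 ^+ 2 + 2 * s * z1 * z2 + t * z2 ^+ 2) -
        2 * (r * x1 * z1 + s * (x1 * z2 + x2 * z1) + t * x2 * z2) *
          (r2 * x1 * z1 + s2 * (x1 * z2 + x2 * z1) + t2 * x2 * z2) - 2 * T112 ^+ 2).
      by rewrite hxx hzz hxz; ring.
    rewrite /T111 /T112 /T122 /Q1111 /Q1122 /pxx /qxx /pzz /qzz /r1 /s1 /t1; ring.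
  rewrite eq2 cW -[RHS]mulr1 -[X in _ = _ * X]dets; ring.
apply: (frame_bound (W := W) (l1 := L) (l2 := l2) (P1 := P1) (P2 := P2) (f1 := f1)
  (f2 := f2) (N := W * (X3 - P1 * f1 - P2 * f2))) => //.
  by rewrite he gerBl.
apply: (@pogorelov_combination R W L l2 e P1 P2 f1 f2 X3 T111 T112 T122 T222 Q1111 Q1122) => //.
- by rewrite -[RHS]h1; ring.
- by rewrite -[RHS]h2; ring.
- by apply: le_trans i1; rewrite le_eqVlt; apply/orP; left; apply/eqP; ring.
- by apply: le_trans i2; rewrite le_eqVlt; apply/orP; left; apply/eqP; ring.
Qed.

(** * The estimate at an interior maximum *)

Lemma smooth_on_sub (R : realType) (O O' : set (R * R)) (u : R -> R -> R) :
  O' `<=` O -> smooth_on O u -> smooth_on O' u.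
Proof. by move=> sub su l a b Oab; exact: su l a b (sub _ Oab). Qed.

Lemma distY_sqr (R : realType) (u : R -> R -> R) (Y1 Y2 Y3 a b : R) :
  distY u Y1 Y2 Y3 a b ^+ 2 = (a - Y1) ^+ 2 + (b - Y2) ^+ 2 + (u a b - Y3) ^+ 2.
Proof. by rewrite sqr_sqrtr// !addr_ge0// sqr_ge0. Qed.

(** On an open set where the distance term is positive, the positive part in [etaY] disappears and
    the function to be differentiated is smooth. *)
Lemma local_max_estimate (R : realType) (O : set (R * R)) (u : R -> R -> R)
    (Y1 Y2 Y3 Rad c a b : R) :
  open O -> smooth_on O u -> O (a, b) -> 0 < c -> 0 < Lambda u a b ->
  (forall x y, O (x, y) -> gauss_curv u x y = c * normal_e3 u x y) ->
  (forall x y, O (x, y) -> 0 < distY u Y1 Y2 Y3 x y ^+ 2 - Rad ^+ 2) ->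
  (forall x y, O (x, y) ->
    (distY u Y1 Y2 Y3 x y ^+ 2 - Rad ^+ 2) * Lambda u x y <=
    (distY u Y1 Y2 Y3 a b ^+ 2 - Rad ^+ 2) * Lambda u a b) ->
  (distY u Y1 Y2 Y3 a b ^+ 2 - Rad ^+ 2) * Lambda u a b <=
    9 / 2 * c * distY u Y1 Y2 Y3 a b ^+ 3.
Proof.
move=> oO su Oab c0 L0 K eta0 mx.
have [x1 [x2 [z1 [z2 fr]]]] :=
  principal_frame (Wf_gt0 u a b) (Wf_sqr u a b) (Lambda_pencil u a b).
have eqn x y : O (x, y) -> dx (dx u) x y * dy (dy u) x y - dy (dx u) x y ^+ 2 =
    c * Wf u x y ^+ 3.
  move=> Oxy; rewrite -gauss_curvE K// /normal_e3.
  by move: (lt0r_neq0 (Wf_gt0 u x y)); move: (Wf u x y) => W nW; field.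
(* Positivity of the distance term lets [second_form_le] be multiplied by it; maximality of the
   product then bounds the result. *)
have touch (al be s v1 v2 : R) : O (a + s * al, b + s * be) ->
   ((a - Y1 + s * al) ^+ 2 + (b - Y2 + s * be) ^+ 2 +
     (pderiv u 0 0 (a + s * al) (b + s * be) - Y3) ^+ 2 - Rad ^+ 2) *
   (pderiv u 2 0 (a + s * al) (b + s * be) * v1 ^+ 2 +
     2 * pderiv u 1 1 (a + s * al) (b + s * be) * v1 * v2 +
     pderiv u 0 2 (a + s * al) (b + s * be) * v2 ^+ 2) <=
   (distY u Y1 Y2 Y3 a b ^+ 2 - Rad ^+ 2) * Lambda u a b *
     (Wf u (a + s * al) (b + s * be) * (v1 ^+ 2 + v2 ^+ 2 +
       (pderiv u 1 0 (a + s * al) (b + s * be) * v1 + pderiv u 0 1 (a + s * al) (b + s * be) * v2) ^+ 2)).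
  move=> Os; have e0 := eta0 _ _ Os; have le1 := mx _ _ Os.
  have := second_form_le u (a + s * al) (b + s * be) v1 v2.
  rewrite -[leRHS]mulrA => le2.
  have -> : (a - Y1 + s * al) ^+ 2 + (b - Y2 + s * be) ^+ 2 +
     (pderiv u 0 0 (a + s * al) (b + s * be) - Y3) ^+ 2 - Rad ^+ 2 =
     distY u Y1 Y2 Y3 (a + s * al) (b + s * be) ^+ 2 - Rad ^+ 2.
    by rewrite distY_sqr (addrAC a) (addrAC b).
  have g0 : 0 <= Wf u (a + s * al) (b + s * be) * (v1 ^+ 2 + v2 ^+ 2 +
      (pderiv u 1 0 (a + s * al) (b + s * be) * v1 + pderiv u 0 1 (a + s * al) (b + s * be) * v2) ^+ 2).
    by rewrite mulr_ge0 ?(ltW (Wf_gt0 _ _ _))// !addr_ge0// sqr_ge0.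
  apply: le_trans (ler_wpM2r g0 le1); rewrite -[leRHS]mulrA.
  exact: (ler_wpM2l (ltW e0) le2).
have nx := near_line x1 x2 oO Oab; have nz := near_line z1 z2 oO Oab.
apply: (@frame_estimate R (fun i j => pderiv u i j a b)
  (fun i j s => pderiv u i j (a + s * x1) (b + s * x2))
  (fun i j s => pderiv u i j (a + s * z1) (b + s * z2))
  x1 x2 z1 z2 (a - Y1) (b - Y2) Y3 (Rad ^+ 2) (Wf u a b) (Lambda u a b) c) => //.
- exact: Wf_gt0.
- exact: Wf_sqr.
- by move=> i j; exact: (jet2_line i j x1 x2 oO su Oab).
- by move=> i j; exact: (jet2_line i j z1 z2 oO su Oab).
- by apply: filterS nx => s; exact: eqn.
- by apply: filterS nz => s; exact: eqn.
- by apply: filterS nx => s Os v1 v2; exact: touch.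
- by apply: filterS nz => s Os v1 v2; exact: touch.
- exact: eta0.
- exact: sqrtr_ge0.
- exact: distY_sqr.
- exact: sqr_ge0.
- exact: eqn.
Qed.

(** * Continuity, compactness and the global bound *)

Lemma continuous_geometry (R : realType) (O : set (R * R)) (u : R -> R -> R)
    (Y1 Y2 Y3 : R) (z : R * R) :
  smooth_on O u -> O z ->
  {for z, continuous (fun z : R * R => distY u Y1 Y2 Y3 z.1 z.2 ^+ 2)} /\
  {for z, continuous (fun z : R * R => lambda1 u z.1 z.2)}.
Proof.
move=> su Oz.
have cD l : {for z, continuous (fun z : R * R => diter l u z.1 z.2)}.
  by case: z Oz => x y Oz; have [] := su l x y Oz.
have c1 : {for z, continuous (fun z : R * R => z.1)} by exact: cvg_fst.
have c2 : {for z, continuous (fun z : R * R => z.2)} by exact: cvg_snd.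
have ck (k : R) : {for z, continuous (fun _ : R * R => k)} by exact: cvg_cst.
have cX (f : R * R -> R) n : {for z, continuous f} ->
    {for z, continuous (fun z => f z ^+ n)}.
  by move=> cf; exact: (@continuous_comp _ _ _ f (fun x => x ^+ n) z cf (@exprn_continuous R n (f z))).
have cA (f g : R * R -> R) : {for z, continuous f} -> {for z, continuous g} ->
    {for z, continuous (fun z => f z + g z)} by move=> cf cg; exact: continuousD cf cg.
have cS (f g : R * R -> R) : {for z, continuous f} -> {for z, continuous g} ->
    {for z, continuous (fun z => f z - g z)} by move=> cf cg; exact: continuousB cf cg.
have cM (f g : R * R -> R) : {for z, continuous f} -> {for z, continuous g} ->
    {for z, continuous (fun z => f z * g z)} by move=> cf cg; exact: continuousM cf cg.
have cR (f : R * R -> R) : {for z, continuous f} ->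
    {for z, continuous (fun z => Num.sqrt (f z))}.
  by move=> cf; exact: (@continuous_comp _ _ _ f Num.sqrt z cf (@sqrt_continuous R (f z))).
split.
  have -> : (fun z : R * R => distY u Y1 Y2 Y3 z.1 z.2 ^+ 2) =
    (fun z => (z.1 - Y1) ^+ 2 + (z.2 - Y2) ^+ 2 + (u z.1 z.2 - Y3) ^+ 2).
    by apply: funext => w; rewrite distY_sqr.
  apply: (cA _ _ (cA _ _ (cX _ _ (cS _ _ c1 (ck Y1))) (cX _ _ (cS _ _ c2 (ck Y2))))).
  exact: (cX _ _ (cS _ _ (cD [::]) (ck Y3))).
have cp := cD [:: true]; have cq := cD [:: false].
have cr := cD [:: true; true]; have cs := cD [:: false; true].
have ct := cD [:: false; false].
have cW : {for z, continuous (fun z : R * R => Wf u z.1 z.2)}.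
  exact: (cR _ (cA _ _ (cA _ _ (ck 1) (cX _ 2 cp)) (cX _ 2 cq))).
have cWi : {for z, continuous (fun z : R * R => (Wf u z.1 z.2 ^+ 3)^-1)}.
  have := cX _ 3 cW; apply: continuousV.
  by rewrite expf_eq0 /= gt_eqF// Wf_gt0.
have c11 := cM _ _ cWi (cS _ _ (cM _ _ (cA _ _ (ck 1) (cX _ 2 cq)) cr) (cM _ _ (cM _ _ cp cq) cs)).
have c12 := cM _ _ cWi (cS _ _ (cM _ _ (cA _ _ (ck 1) (cX _ 2 cq)) cs) (cM _ _ (cM _ _ cp cq) ct)).
have c21 := cM _ _ cWi (cS _ _ (cM _ _ (cA _ _ (ck 1) (cX _ 2 cp)) cs) (cM _ _ (cM _ _ cp cq) cr)).
have c22 := cM _ _ cWi (cS _ _ (cM _ _ (cA _ _ (ck 1) (cX _ 2 cp)) ct) (cM _ _ (cM _ _ cp cq) cs)).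
have cH := cA _ _ c11 c22; have cK := cS _ _ (cM _ _ c11 c22) (cM _ _ c12 c21).
exact: (cM _ _ (cA _ _ cH (cR _ (cS _ _ (cX _ 2 cH) (cM _ _ (ck 4) cK)))) (ck 2^-1)).
Qed.

Lemma gauss_curv_lambda (R : realType) (u : R -> R -> R) a b :
  gauss_curv u a b = lambda1 u a b * lambda2 u a b.
Proof.
have := sqr_sqrtr (curvature_discriminant u a b); rewrite /lambda1 /lambda2.
move: (Num.sqrt (mean_trace u a b ^+ 2 - 4 * gauss_curv u a b)) => S.
move: (mean_trace u a b) (gauss_curv u a b) => H K SE.
have -> : (H + S) / 2 * ((H - S) / 2) = (H ^+ 2 - S ^+ 2) / 4 by field.
by rewrite SE; field.
Qed.

Theorem theorem3p1 (R : realType) (Om : set (R * R)) (u : R -> R -> R)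
  (Y1 Y2 Y3 Rad : R) (S : set (R * R)) :
  (* Omega open, bounded, convex (and nonempty) *)
  open Om -> bounded_set2 Om -> convex_set2 Om -> Om !=set0 ->
  (* Sigma = graph of u over Omega: smooth, convex, strictly convex *)
  smooth_on Om u -> convex_fun_on Om u ->
  (forall a b, Om (a, b) -> 0 < lambda1 u a b /\ 0 < lambda2 u a b) ->
  (* K = 2 pi / A(Omega) <n, e3> *)
  (forall a b, Om (a, b) ->
     gauss_curv u a b = 2 * pi / area Om * normal_e3 u a b) ->
  (* completeness: |Du| -> +oo at the boundary of Omega *)
  (forall z, closure Om z -> ~ Om z -> forall M : R,
     \forall w \near z, Om w -> M < gradnorm u w.1 w.2) ->
  (* Sigma_c: compact surface with boundary in Sigma, boundary on dB_R(Y) *)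
  0 < Rad -> compact S -> S `<=` Om -> S = closure (interior S) ->
  (forall z, S z -> ~ (interior S) z -> distY u Y1 Y2 Y3 z.1 z.2 = Rad) ->
  forall a b, S (a, b) ->
    etaY u Y1 Y2 Y3 Rad a b * Lambda u a b
      <= 9 * pi / area Om *
         sup [set r | exists q, S q /\ r = distY u Y1 Y2 Y3 q.1 q.2 ^+ 3].
Proof.
move=> oO _ _ _ su _ lpos K _ Rad0 cS SO _ bS a b Sab.
have S0 : S !=set0 by exists (a, b).
pose c := 2 * pi / area Om.
pose g (z : R * R) := distY u Y1 Y2 Y3 z.1 z.2 ^+ 2.
have cg z : S z -> {for z, continuous g}.
  by move=> Sz; have [] := continuous_geometry Y1 Y2 Y3 su (SO _ Sz).
(* The sign of [c] is read off the curvature equation at [(a, b)], where K is a product of positive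
   curvatures. This also excludes the default value 0 of a division by zero. *)
have c0 : 0 < c.
  have [l1 l2] := lpos _ _ (SO _ Sab).
  have := mulr_gt0 l1 l2; rewrite -gauss_curv_lambda (K _ _ (SO _ Sab)) /normal_e3 -/c.
  by rewrite pmulr_lgt0// invr_gt0 Wf_gt0.
pose rhs := 9 / 2 * c * sup [set r | exists q, S q /\ r = distY u Y1 Y2 Y3 q.1 q.2 ^+ 3].
have -> : 9 * pi / area Om *
    sup [set r | exists q, S q /\ r = distY u Y1 Y2 Y3 q.1 q.2 ^+ 3] = rhs.
  rewrite /rhs /c; congr (_ * _).
  by move: (area Om)^-1 => v; field.
(* [sup] dominates the elements of a set only if the set is bounded above; a point of [S] farthest
   from Y provides the bound. *)
have dist_sup (x y : R) : S (x, y) -> 9 / 2 * c * distY u Y1 Y2 Y3 x y ^+ 3 <= rhs.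
  move=> Sxy; rewrite /rhs; apply: ler_wpM2l; first by rewrite mulr_ge0// ltW.
  have [q Sq qmax] : exists2 q, q \in S & forall t, t \in S -> g t <= g q.
    apply: compact_EVT_max => //; apply: continuous_in_subspaceT => z.
    by rewrite inE; exact: cg.
  apply: ub_le_sup; last by exists (x, y).
  exists (distY u Y1 Y2 Y3 q.1 q.2 ^+ 3) => r [t [St ->]].
  rewrite ler_pXn2r ?nnegrE ?sqrtr_ge0//.
  by rewrite -(@ler_pXn2r _ 2) ?nnegrE ?sqrtr_ge0//; apply: qmax; rewrite inE.
have rhs0 : 0 <= rhs.
  apply: le_trans (dist_sup _ _ Sab).
  by rewrite mulr_ge0 ?exprn_ge0 ?sqrtr_ge0// mulr_ge0// ltW.
have Lpos x y : S (x, y) -> 0 < Lambda u x y.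
  by move=> Sxy; rewrite Lambda_lambda1; have [] := lpos _ _ (SO _ Sxy).
(* Without the positive part and with [lambda1] for [Lambda], the function is visibly continuous;
   where it is positive it agrees with eta times [Lambda]. *)
pose phi (z : R * R) := (g z - Rad ^+ 2) * lambda1 u z.1 z.2.
have [[a0 b0] /set_mem Sp pmax] : exists2 q, q \in S & forall t, t \in S -> phi t <= phi q.
  apply: compact_EVT_max => //; apply: continuous_in_subspaceT => z.
  rewrite inE => Sz; have [_ cl] := continuous_geometry Y1 Y2 Y3 su (SO _ Sz).
  exact: continuousM (continuousB (cg z Sz) (@cst_continuous _ _ (Rad ^+ 2) z)) cl.
have key : phi (a0, b0) <= rhs.
  have [neg|pos] := leP (phi (a0, b0)) 0; first exact: le_trans neg rhs0.
  have L0 := Lpos _ _ Sp.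
  have g0 : 0 < g (a0, b0) - Rad ^+ 2.
    by move: pos; rewrite /phi pmulr_lgt0// -Lambda_lambda1.
  (* Boundary points lie on the sphere, where [g] equals [Rad ^+ 2], so a positive maximum is
     interior. *)
  have Ip : interior S (a0, b0).
    apply: contrapT => nI; have := bS _ Sp nI; rewrite /= => dE.
    by move: g0; rewrite /g /= dE subrr ltxx.
  (* Shrinking to an open set inside [S] keeps the comparison with the maximum and makes the
     distance term positive at every point. *)
  pose O' := interior (S `&` [set z | Rad ^+ 2 < g z]).
  have Op : O' (a0, b0).
    apply: filterI Ip _; apply: (cg _ Sp [set y | Rad ^+ 2 < y]).
    by apply: lt_nbhsr; rewrite -subr_gt0.
  have OS x y : O' (x, y) -> S (x, y) /\ Rad ^+ 2 < g (x, y).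
    by move=> /interior_subset.
  have suO : smooth_on O' u.
    by apply: smooth_on_sub su => -[x y] /OS[/SO].
  apply: le_trans (dist_sup _ _ Sp).
  rewrite /phi -Lambda_lambda1.
  apply: (local_max_estimate (open_interior _) suO Op c0 L0).
  - by move=> x y /OS[/SO Oxy _]; exact: K.
  - by move=> x y /OS[_ gxy]; rewrite subr_gt0.
  - move=> x y /OS[Sxy _]; rewrite !Lambda_lambda1.
    by apply: (pmax (x, y)); rewrite inE.
rewrite /etaY; have [ge0|lt0] := leP 0 (distY u Y1 Y2 Y3 a b ^+ 2 - Rad ^+ 2).
  apply: le_trans key; rewrite Lambda_lambda1.
  by apply: (pmax (a, b)); rewrite inE.
by rewrite mul0r.
Qed.
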